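(* Let $k$ be a positive integer and let $z\in\mathbb{C}$ with $\Re(z)\ge 0$, $z\ne 0$, and $k\le |z|$. Then $$\left|\frac{R_{k+1}(z)}{T_k(z)}\right| < \frac{(k/|z|)^2}{\pi^2-1} \le \frac{1}{\pi^2-1} < 0.113$$ and $$\left|\frac{R_{k}(z)}{T_k(z)}\right| < 1 + \frac{(k/|z|)^2}{\pi^2-1} \le \frac{\pi^2}{\pi^2-1} < 1.113.$$
   Context: $\log$ is the principal branch of the logarithm on $\mathbb{C}\setminus(-\infty,0]$. $\ln\Gamma$ denotes the analytic function on $\mathbb{C}\setminus(-\infty,0]$ with $\exp(\ln\Gamma(z))=\Gamma(z)$ that is real and equal to $\log(\Gamma(x))$ for real $x>0$. $B_{2j}$ are the Bernoulli numbers ($B_2=\frac16$, $B_4=-\frac1{30}$, etc.). For integers $j\ge1$, $$T_j(z) = \frac{B_{2j}}{2j(2j-1)z^{2j-1}},$$ and for integers $k\ge 1$ the remainder $R_k(z)$ in Stirling's approximation is defined by $$\ln\Gamma(z) = (z-\tfrac12)\log z - z + \tfrac12\log(2\pi) + \sum_{j=1}^{k-1} T_j(z) + R_k(z).$$ *)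

(* Defs.v *)
From Stdlib Require Import Reals Arith Lra Lia Psatz.
From Coquelicot Require Import Coquelicot.
Open Scope R_scope.

Definition slit_plane (z : C) : Prop := ~ (Re z <= 0 /\ Im z = 0).

Definition Cexp (z : C) : C :=
  (exp (Re z) * cos (Im z), exp (Re z) * sin (Im z)).

(** On the slit plane, [2 * atan (y / (|z| + x))] is the argument of
    [z = x + i y] in the open interval from [-PI] to [PI] (half-angle formula);
    see [Cexp_Clog] and [Im_Clog_bound]. *)
Definition Clog (z : C) : C :=
  (ln (Cmod z), 2 * atan (Im z / (Cmod z + Re z))).

Fixpoint rising (z : C) (n : nat) : C :=
  match n with
  | O => 1
  | S m => rising z m * (z + INR m)
  end%C.

(** Euler-Gauss limit formula, valid for every [z] other than 0, -1, -2, ...: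
    [Gamma z] is the limit of [n! n^z / (z (z + 1) ... (z + n))]. The limit is
    taken on real and imaginary parts. *)
Definition Gamma_approx (z : C) (n : nat) : C :=
  (INR (fact n) * Cexp (z * ln (INR n)) / rising z (S n))%C.

Definition Gamma (z : C) : C :=
  (real (Lim_seq (fun n => Re (Gamma_approx z n))),
   real (Lim_seq (fun n => Im (Gamma_approx z n)))).

(** [is_lnGamma L]: on the slit plane [L] is the holomorphic branch of the
    logarithm of [Gamma] that is real on the positive reals. These properties
    determine [L] on the slit plane; its values elsewhere are irrelevant. *)
Definition is_lnGamma (L : C -> C) : Prop :=
  (forall z : C, slit_plane z ->
     ex_derive (K := C_AbsRing) (V := C_NormedModule) L z) /\
  (forall z : C, slit_plane z -> Cexp (L z) = Gamma z) /\
  (forall x : R, 0 < x ->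
     Im (L (RtoC x)) = 0 /\ L (RtoC x) = Clog (Gamma (RtoC x))).

(** [bernoulli_upto n i] is the Bernoulli number [B_i] for [i <= n], computed
    from [B_0 = 1] and
    [sum_(i <= m) binomial(m+1, i) B_i = 0] for [m >= 1]. *)
Fixpoint bernoulli_upto (n : nat) : nat -> R :=
  match n with
  | O => fun _ => 1
  | S m => fun i =>
      if (i <=? m)%nat then bernoulli_upto m i
      else - / INR (m + 2) *
           sum_f_R0 (fun j => Binomial.C (m + 2) j * bernoulli_upto m j) m
  end.

Definition bernoulli (n : nat) : R := bernoulli_upto n n.

(** Meaningful for [j >= 1]. *)
Definition stirling_term (j : nat) (z : C) : C :=
  (bernoulli (2 * j) / (INR (2 * j * (2 * j - 1)) * z ^ (2 * j - 1)))%C.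

(** The remainder [R_k(z)], for [k >= 1], relative to a choice [L] of
    log-Gamma; [sum_n_m] is 0 when [k = 1]. *)
Definition stirling_remainder (L : C -> C) (k : nat) (z : C) : C :=
  (L z - ((z - / 2) * Clog z - z + / 2 * ln (2 * PI)
          + sum_n_m (G := C_AbelianMonoid)
              (fun j => stirling_term j z) 1 (k - 1)))%C.

Lemma slit_plane_pos (z : C) : slit_plane z -> 0 < Cmod z + Re z.
Proof.
intros Hz.
assert (H0 := Cmod_ge_0 z). assert (H2 := Cmod2_alt z).
destruct (Rlt_or_le 0 (Re z)) as [h|h]; [lra|].
destruct (Req_dec (Im z) 0) as [e|e]; [exfalso; apply Hz; lra|].
destruct (Rlt_or_le 0 (Cmod z + Re z)) as [g|g]; [easy|exfalso].
assert (0 < Im z ^ 2) by (apply pow2_gt_0; easy). nra.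
Qed.

Lemma Cexp_Clog (z : C) : slit_plane z -> Cexp (Clog z) = z.
Proof.
intros Hz. assert (Hp := slit_plane_pos z Hz).
assert (H0 := Cmod_ge_0 z). assert (H2 := Cmod2_alt z).
assert (Hr : 0 < Cmod z).
{ destruct H0 as [H0|H0]; [easy|exfalso].
  apply Hz. rewrite <- H0 in H2. assert (Re z = 0) by nra.
  assert (Im z = 0) by nra. lra. }
set (r := Cmod z) in *. set (s := Im z / (r + Re z)).
change (Cexp (Clog z)) with
  (exp (ln r) * cos (2 * atan s), exp (ln r) * sin (2 * atan s)).
rewrite exp_ln by easy.
set (a := atan s).
assert (Hc : 0 < cos a) by (apply cos_gt_0; unfold a; destruct (atan_bound s); lra).
assert (Ht : sin a = s * cos a).
{ assert (h := tan_atan s). fold a in h. unfold tan in h.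
  rewrite <- h. field. lra. }
assert (Hs : s * (r + Re z) = Im z) by (unfold s; field; lra).
assert (H1 : cos a * cos a * (1 + s * s) = 1).
{ assert (h := sin2_cos2 a). unfold Rsqr in h. rewrite Ht in h. lra. }
assert (E : cos a * cos a * (2 * r) = r + Re z).
{ apply (Rmult_eq_reg_r (1 + s * s)); [|nra].
  replace (cos a * cos a * (2 * r) * (1 + s * s)) with
    (cos a * cos a * (1 + s * s) * (2 * r)) by ring. rewrite H1.
  apply (Rmult_eq_reg_r (r + Re z)); [|lra].
  replace ((r + Re z) * (1 + s * s) * (r + Re z)) with
    ((r + Re z) ^ 2 + (s * (r + Re z)) ^ 2) by ring.
  rewrite Hs. lra. }
rewrite cos_2a_cos, sin_2a, Ht.
rewrite (surjective_pairing z); fold (Re z) (Im z).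
f_equal; [lra|].
rewrite <- Hs. rewrite <- E. ring.
Qed.

Lemma Im_Clog_bound (z : C) : - PI < Im (Clog z) < PI.
Proof.
change (Im (Clog z)) with (2 * atan (Im z / (Cmod z + Re z))).
destruct (atan_bound (Im z / (Cmod z + Re z))); lra.
Qed.

Lemma bernoulli_upto_eq (n i : nat) :
  (i <= n)%nat -> bernoulli_upto n i = bernoulli i.
Proof.
intros Hi; induction Hi as [|n Hi IH]; [easy|].
cbn [bernoulli_upto]. now rewrite (proj2 (Nat.leb_le i n) Hi).
Qed.

Lemma bernoulli_0 : bernoulli 0 = 1.
Proof. easy. Qed.

Lemma bernoulli_S (m : nat) :
  bernoulli (S m) = - / INR (m + 2) *
    sum_f_R0 (fun j => Binomial.C (m + 2) j * bernoulli j) m.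
Proof.
unfold bernoulli at 1; cbn [bernoulli_upto].
rewrite (proj2 (Nat.leb_gt (S m) m)) by lia. f_equal.
apply sum_eq; intros i Hi. now rewrite bernoulli_upto_eq.
Qed.

Lemma bernoulli_1 : bernoulli 1 = - / 2.
Proof.
rewrite bernoulli_S; cbn [sum_f_R0]. rewrite bernoulli_0.
unfold Binomial.C; cbn; field.
Qed.

Lemma bernoulli_2 : bernoulli 2 = / 6.
Proof.
rewrite bernoulli_S; cbn [sum_f_R0]. rewrite bernoulli_0, bernoulli_1.
unfold Binomial.C; cbn; field.
Qed.

Lemma bernoulli_3 : bernoulli 3 = 0.
Proof.
rewrite bernoulli_S; cbn [sum_f_R0].
rewrite bernoulli_0, bernoulli_1, bernoulli_2.
unfold Binomial.C; cbn; field.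
Qed.

Lemma bernoulli_4 : bernoulli 4 = - / 30.
Proof.
rewrite bernoulli_S; cbn [sum_f_R0].
rewrite bernoulli_0, bernoulli_1, bernoulli_2, bernoulli_3.
unfold Binomial.C; cbn; field.
Qed.

(* Main.v *)
Require Import Defs.
From Stdlib Require Import Reals.
From Coquelicot Require Import Coquelicot.
From Stdlib Require Import Arith Lra Lia Psatz Machin.
Open Scope R_scope.

(** Write [beta n] for [B_n / n!] and [bpoly n] for the Bernoulli polynomial
    divided by [n!], so that differentiation lowers the index. For [z <> 0] in
    the closed right half-plane let [S_n(z)] ([em_limit n z]) be the integral
    over [u >= 0] of [bpoly n ({u}) / (z + u)^n], where [{u}] is the fractional
    part of [u]. Integration by parts gives
      [S_n(z) = - beta (n + 1) / z^n + n * S_(n+1)(z)],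
    and iterating it from [n = 1] produces Stirling's series. Its remainder after
    the term [T_m] is [- (2 m - 1)! * S_(2m)(z)].

    That the given branch of log-Gamma has this remainder is shown in two steps.
    The logarithm of the Gauss product is a sum of logarithms, and
    Euler-Maclaurin summation identifies its limit as Stirling's formula with
    error term [- S_1], the constant coming from Wallis's integrals
    ([Gamma_eq_Cexp]). Two logarithms of Gamma then differ by a multiple of
    [2 i PI]; following the segment from [|z|] to [z] shows that it is zero
    ([lnGamma_eq]).

    The estimate rests on the quotients [a_n = |R_(n+1) / T_n|], about which two
    things are true. First, [|bpoly (2 n)|] is at most its value at [0] and
    [|z + u|^2 >= |z|^2 + u^2], so [a_n] is at most [(2 n - 1)] times the Wallis
    integral of order [2 n - 2], a quantity of order [sqrt n]
    ([remainder_ratio_cap]). Second, [R_(n+1) = T_(n+1) + R_(n+2)], and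
    [|T_(n+1) / T_n|] is at most [n (n - 1/2) / (PI |z|)^2], because
    [(2 PI)^2 |beta (2 n + 2)| <= |beta (2 n)|] ([beta_even_ratio]); hence
      [a_n <= n (n - 1/2) / (PI |z|)^2 * (1 + a_(n+1))]
    ([remainder_ratio_step]). For [n] close to [k <= |z|] the factor is about
    [q = 1 / PI^2]. Starting from the first bound at some [n > k] and descending
    to [k], the starting error is reduced nearly tenfold at each step, and the
    result approaches the sum [q / (1 - q) = 1 / (PI^2 - 1)] of a geometric
    series. It stays below that sum because the last factor is
    [q (1 - 1 / (2 k))], which gains more than the growth of the earlier factors
    loses ([first_step_bound]). The last step carries the factor
    [(k / |z|)^2], and the second estimate of the theorem follows from
    [R_k = T_k + R_(k+1)]. *)

(** * Derivatives and integrals of real functions *)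

(** The integral and derivative lemmas of the normed-module hierarchy leave equations at
    a carrier such as [R_AbsRing], which [ring] and [field] do not recognise as [R]. *)
Ltac as_R := match goal with |- @eq _ ?a ?b => change (@eq R a b) end.

Lemma der_plus (f g : R -> R) (x a b : R) :
  is_derive f x a -> is_derive g x b -> is_derive (fun u => f u + g u) x (a + b).
Proof. apply (is_derive_plus (K := R_AbsRing) (V := R_NormedModule)). Qed.

Lemma der_minus (f g : R -> R) (x a b : R) :
  is_derive f x a -> is_derive g x b -> is_derive (fun u => f u - g u) x (a - b).
Proof. apply (is_derive_minus (K := R_AbsRing) (V := R_NormedModule)). Qed.

Lemma der_mult (f g : R -> R) (x a b : R) :
  is_derive f x a -> is_derive g x b ->
  is_derive (fun u => f u * g u) x (a * g x + f x * b).
Proof. intros Hf Hg; apply (is_derive_mult f g); auto; exact Rmult_comm. Qed.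

Lemma der_const (c x : R) : is_derive (fun _ : R => c) x 0.
Proof. apply (is_derive_const (K := R_AbsRing) (V := R_NormedModule)). Qed.

Lemma der_scal (f : R -> R) (c x a : R) :
  is_derive f x a -> is_derive (fun u => c * f u) x (c * a).
Proof. apply (is_derive_scal f). Qed.

Lemma der_comp (f g : R -> R) (x a b : R) :
  is_derive f (g x) a -> is_derive g x b -> is_derive (fun u => f (g u)) x (b * a).
Proof. apply (is_derive_comp (K := R_AbsRing) (V := R_NormedModule) f g). Qed.

Lemma der_eq (f : R -> R) (x a b : R) : is_derive f x a -> a = b -> is_derive f x b.
Proof. now intros H <-. Qed.

Lemma is_RInt_inj (f : R -> R) (a b l1 l2 : R) :
  is_RInt f a b l1 -> is_RInt f a b l2 -> l1 = l2.
Proof.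
intros H1 H2. apply (is_RInt_unique (V := R_CompleteNormedModule)) in H1, H2.
now rewrite <- H1, <- H2.
Qed.

Lemma ftc (f df : R -> R) (a b : R) :
  (forall x, is_derive f x (df x)) -> (forall x, continuous df x) ->
  is_RInt df a b (f b - f a).
Proof.
intros Hd Hc. apply (is_RInt_derive (V := R_CompleteNormedModule) f df); auto.
Qed.

Lemma rint_plus (f g : R -> R) (a b lf lg : R) :
  is_RInt f a b lf -> is_RInt g a b lg -> is_RInt (fun u => f u + g u) a b (lf + lg).
Proof. apply (is_RInt_plus (V := R_NormedModule)). Qed.

Lemma rint_minus (f g : R -> R) (a b lf lg : R) :
  is_RInt f a b lf -> is_RInt g a b lg -> is_RInt (fun u => f u - g u) a b (lf - lg).
Proof. apply (is_RInt_minus (V := R_NormedModule)). Qed.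

Lemma rint_scal (f : R -> R) (c a b l : R) :
  is_RInt f a b l -> is_RInt (fun u => c * f u) a b (c * l).
Proof. apply (is_RInt_scal (V := R_NormedModule)). Qed.

(** * Bernoulli polynomials *)

Definition beta (n : nat) : R := bernoulli n / INR (fact n).

(** The Bernoulli polynomial divided by [n!]: with this normalisation differentiation
    only lowers the index, and no binomial coefficient survives. *)
Definition bpoly (n : nat) (u : R) : R :=
  sum_n (fun i => beta i * (u ^ (n - i) / INR (fact (n - i)))) n.

Lemma bpoly_0 (u : R) : bpoly 0 u = 1.
Proof.
unfold bpoly, beta; rewrite sum_O, bernoulli_0; cbn; field.
Qed.

Lemma bpoly_at_0 (n : nat) : bpoly n 0 = beta n.
Proof.
unfold bpoly; destruct n as [|n].
- rewrite sum_O; cbn; field.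
- rewrite sum_Sn, Nat.sub_diag.
  rewrite (sum_n_ext_loc _ (fun _ => 0)).
  + rewrite sum_n_const; cbn; unfold plus; cbn. field.
  + intros i Hi. replace (S n - i)%nat with (S (n - i)) by lia.
    cbn [pow]; unfold Rdiv. rewrite 2!Rmult_0_l. apply Rmult_0_r.
Qed.

Lemma is_derive_bpoly (n : nat) (u : R) : is_derive (bpoly (S n)) u (bpoly n u).
Proof.
apply is_derive_ext with (fun v =>
  sum_n (fun i => beta i * (v ^ (S n - i) / INR (fact (S n - i)))) n + beta (S n)).
{ intros t; unfold bpoly at 1; rewrite sum_Sn, Nat.sub_diag; cbn. unfold plus; cbn; field.
  apply (INR_fact_neq_0 (S n)). }
eapply der_eq; [apply der_plus; [|apply der_const]|apply Rplus_0_r].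
apply (is_derive_sum_n (K := R_AbsRing) (V := R_NormedModule)).
intros i Hi. replace (S n - i)%nat with (S (n - i)) by lia.
generalize (n - i)%nat; intros d. apply der_scal.
eapply der_eq; [auto_derive; [easy|reflexivity]|].
change (fact d + d * fact d)%nat with (S d * fact d)%nat.
change (match d with 0%nat => 1 | S _ => INR d + 1 end) with (INR (S d)).
rewrite mult_INR. field. split; [apply INR_fact_neq_0|now apply not_0_INR].
Qed.

(** This is exactly the defining recursion of the Bernoulli numbers. *)
Lemma bpoly_at_1 (n : nat) : bpoly (S (S n)) 1 = beta (S (S n)).
Proof.
unfold bpoly; rewrite 2!sum_Sn, Nat.sub_diag.
replace (S (S n) - S n)%nat with 1%nat by lia.
enough (sum_n (fun i => beta i * (1 ^ (S (S n) - i) / INR (fact (S (S n) - i)))) n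
        = - beta (S n)) as -> by (unfold plus; cbn; field).
unfold beta at 2; rewrite bernoulli_S, sum_n_Reals.
assert (Hf := INR_fact_neq_0 (S n)).
assert (Hn := not_0_INR (n + 2) ltac:(lia)).
transitivity (/ INR (fact (n + 2)) *
  sum_f_R0 (fun j => Binomial.C (n + 2) j * bernoulli j) n).
- rewrite scal_sum. apply sum_eq; intros i Hi.
  unfold beta, Binomial.C. rewrite pow1.
  replace (n + 2 - i)%nat with (S (S n) - i)%nat by lia.
  field. repeat split; apply INR_fact_neq_0.
- replace (n + 2)%nat with (S (S n)) by lia.
  rewrite (fact_simpl (S n)), mult_INR. as_R. field.
  split; [apply not_0_INR; lia|easy].
Qed.

Lemma continuous_bpoly (n : nat) (u : R) : continuous (bpoly n) u.
Proof.
destruct n as [|n].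
- apply continuous_ext with (fun _ => 1); [intros; now rewrite bpoly_0|apply continuous_const].
- apply (ex_derive_continuous (K := R_AbsRing) (V := R_NormedModule)).
  eexists; apply is_derive_bpoly.
Qed.

Lemma is_derive_0_const (f : R -> R) (a b : R) :
  (forall x, is_derive f x 0) -> f a = f b.
Proof.
intros H.
destruct (Rtotal_order a b) as [h|[h|h]]; [|now subst|symmetry];
  apply (eq_is_derive f); auto.
Qed.

(** Each term of such a sequence is determined up to an additive constant by the
    previous one, and the equal end values of the next term (zero mean on the unit
    interval) fix that constant. Every functional equation below comes from here: both
    sides satisfy the three conditions. *)
Lemma appell_unique (f : nat -> R -> R) :
  (forall u, f 0%nat u = 1) ->
  (forall n u, is_derive (f (S n)) u (f n u)) ->
  (forall n, f (S (S n)) 1 = f (S (S n)) 0) ->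
  forall n u, f n u = bpoly n u.
Proof.
intros H0 HD H1 n; induction n as [|n IH]; intros u; [now rewrite H0, bpoly_0|].
set (c := f (S n) u - bpoly (S n) u).
assert (Hc : forall v, f (S n) v - bpoly (S n) v = c).
{ intros v. apply (is_derive_0_const (fun v => f (S n) v - bpoly (S n) v)).
  intros x. eapply der_eq; [apply der_minus; [apply HD|apply is_derive_bpoly]|].
  rewrite IH; ring. }
assert (Hg : f (S (S n)) 1 - bpoly (S (S n)) 1 - c * 1
           = f (S (S n)) 0 - bpoly (S (S n)) 0 - c * 0).
{ apply (is_derive_0_const (fun v => f (S (S n)) v - bpoly (S (S n)) v - c * v)).
  intros x. eapply der_eq.
  - apply der_minus; [apply der_minus; [apply HD|apply is_derive_bpoly]|].
    apply (der_scal (fun v => v)), is_derive_id.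
  - rewrite <- (Hc x); unfold one; cbn; ring. }
rewrite H1, bpoly_at_1, bpoly_at_0 in Hg. unfold c in Hg; lra.
Qed.

Lemma bpoly_reflect (n : nat) (u : R) : bpoly n (1 - u) = (-1) ^ n * bpoly n u.
Proof.
enough (H : (-1) ^ n * bpoly n (1 - u) = bpoly n u).
{ rewrite <- H, <- Rmult_assoc, <- Rpow_mult_distr.
  replace (-1 * -1) with 1 by ring. rewrite pow1; ring. }
apply (appell_unique (fun n u => (-1) ^ n * bpoly n (1 - u))).
- intros v; rewrite bpoly_0; cbn; ring.
- intros m v.
  eapply der_eq; [apply der_scal, (der_comp (bpoly (S m)) (fun x => 1 - x));
    [apply is_derive_bpoly|auto_derive; [easy|reflexivity]]|cbn [pow]; ring].
- intros m. replace (1 - 1) with 0 by ring. rewrite Rminus_0_r, bpoly_at_1, bpoly_at_0. easy.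
Qed.

Lemma bpoly_duplication (n : nat) (u : R) :
  2 ^ n / 2 * (bpoly n (u / 2) + bpoly n ((u + 1) / 2)) = bpoly n u.
Proof.
apply (appell_unique (fun n u => 2 ^ n / 2 * (bpoly n (u / 2) + bpoly n ((u + 1) / 2)))).
- intros v; rewrite !bpoly_0; cbn; field.
- intros m v.
  eapply der_eq; [apply der_scal, der_plus|].
  + apply (der_comp (bpoly (S m)) (fun x => x / 2)); [apply is_derive_bpoly|].
    auto_derive; [easy|reflexivity].
  + apply (der_comp (bpoly (S m)) (fun x => (x + 1) / 2)); [apply is_derive_bpoly|].
    auto_derive; [easy|reflexivity].
  + cbn [pow]; field.
- intros m. replace ((1 + 1) / 2) with 1 by field. replace ((0 + 1) / 2) with (1 / 2) by field.
  replace (0 / 2) with 0 by field. rewrite bpoly_at_1, bpoly_at_0. ring.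
Qed.

Lemma pow_m1_even (m : nat) : (-1) ^ (2 * m) = 1.
Proof. rewrite pow_mult. replace ((-1) ^ 2) with 1 by ring. apply pow1. Qed.

Lemma pow_m1_odd (m : nat) : (-1) ^ (2 * m + 1) = -1.
Proof. rewrite pow_add, pow_m1_even; ring. Qed.

Lemma beta_odd (m : nat) : (1 <= m)%nat -> beta (2 * m + 1) = 0.
Proof.
intros Hm. assert (H := bpoly_reflect (2 * m + 1) 0).
rewrite Rminus_0_r, bpoly_at_0, pow_m1_odd in H.
replace (2 * m + 1)%nat with (S (S (2 * m - 1))) in * by lia.
rewrite bpoly_at_1 in H. lra.
Qed.

Lemma bpoly_odd_half (m : nat) : bpoly (2 * m + 1) (1 / 2) = 0.
Proof.
assert (H := bpoly_reflect (2 * m + 1) (1 / 2)).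
rewrite pow_m1_odd in H. replace (1 - 1 / 2) with (1 / 2) in H by field. lra.
Qed.

Lemma bpoly_half (n : nat) : bpoly n (1 / 2) = (2 / 2 ^ n - 1) * beta n.
Proof.
assert (H := bpoly_duplication n 0).
replace (0 / 2) with 0 in H by field. replace ((0 + 1) / 2) with (1 / 2) in H by field.
rewrite bpoly_at_0 in H. assert (2 ^ n <> 0) by (apply pow_nonzero; lra).
apply (Rmult_eq_reg_l (2 ^ n / 2)); [|apply Rmult_integral_contrapositive; split; lra].
rewrite Rmult_plus_distr_l in H.
transitivity (beta n - 2 ^ n / 2 * beta n); [lra|field; easy].
Qed.

(** If [f u <= 0], the mean value theorem on both sides of [u] gives a nonpositive slope
    followed by a nonnegative one, against concavity. *)
Lemma concave_zero_ends_pos (f f1 f2 : R -> R) (a b : R) :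
  (forall u, is_derive f u (f1 u)) -> (forall u, is_derive f1 u (f2 u)) ->
  (forall u, a < u < b -> f2 u < 0) -> f a = 0 -> f b = 0 ->
  forall u, a < u < b -> 0 < f u.
Proof.
intros D1 D2 Hneg Ha Hb u Hu.
destruct (MVT_cor2 f f1 a u) as (c1 & E1 & I1); [lra|intros; now apply is_derive_Reals|].
destruct (MVT_cor2 f f1 u b) as (c2 & E2 & I2); [lra|intros; now apply is_derive_Reals|].
destruct (MVT_cor2 f1 f2 c1 c2) as (c3 & E3 & I3); [lra|intros; now apply is_derive_Reals|].
assert (f2 c3 < 0) by (apply Hneg; lra).
apply Rnot_le_lt; intros Hle.
assert (f1 c1 <= 0) by nra. assert (0 <= f1 c2) by nra. nra.
Qed.

(** By induction: the second derivative of the next odd polynomial is the present one,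
    which has a fixed sign, and all odd polynomials from the third on vanish at [0] and
    [1/2]. *)
Lemma bpoly_odd_sign (m : nat) (u : R) :
  0 < u < 1 / 2 -> 0 < (-1) ^ S m * bpoly (2 * m + 1) u.
Proof.
revert u; induction m as [|m IH]; intros u Hu.
- change (2 * 0 + 1)%nat with 1%nat. unfold bpoly, beta.
  rewrite sum_Sn, sum_O, bernoulli_0, bernoulli_1; unfold plus; cbn. lra.
- replace (2 * S m + 1)%nat with (S (S (2 * m + 1))) by lia.
  apply (concave_zero_ends_pos (fun u => (-1) ^ S (S m) * bpoly (S (S (2 * m + 1))) u)
    (fun u => (-1) ^ S (S m) * bpoly (S (2 * m + 1)) u)
    (fun u => (-1) ^ S (S m) * bpoly (2 * m + 1) u) 0 (1 / 2)); auto.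
  + intros v. apply der_scal, is_derive_bpoly.
  + intros v. apply der_scal, is_derive_bpoly.
  + intros v Hv. specialize (IH v Hv). cbn [pow] in *. lra.
  + replace (S (S (2 * m + 1))) with (2 * S m + 1)%nat by lia.
    rewrite bpoly_at_0, beta_odd by lia. ring.
  + replace (S (S (2 * m + 1))) with (2 * S m + 1)%nat by lia.
    rewrite bpoly_odd_half. ring.
Qed.

Lemma bpoly_even_increasing (m : nat) (u v : R) :
  0 <= u -> u < v -> v <= 1 / 2 ->
  (-1) ^ S m * bpoly (2 * S m) u < (-1) ^ S m * bpoly (2 * S m) v.
Proof.
intros Hu Huv Hv. replace (2 * S m)%nat with (S (2 * m + 1)) by lia.
destruct (MVT_cor2 (fun u => (-1) ^ S m * bpoly (S (2 * m + 1)) u)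
   (fun u => (-1) ^ S m * bpoly (2 * m + 1) u) u v Huv) as (c & E & I).
{ intros c _. apply is_derive_Reals.
  apply der_scal, is_derive_bpoly. }
assert (H := bpoly_odd_sign m c ltac:(lra)). nra.
Qed.

Lemma beta_even_neq_0 (m : nat) : (1 <= m)%nat -> beta (2 * m) <> 0.
Proof.
intros Hm E. destruct m as [|m]; [lia|].
assert (H := bpoly_even_increasing m 0 (1 / 2) ltac:(lra) ltac:(lra) ltac:(lra)).
rewrite bpoly_half, bpoly_at_0, E in H. lra.
Qed.

(** On [[0, 1/2]] the polynomial is monotone, so its extreme values are those at [0] and
    [1/2]; the duplication formula shows that the second is the smaller in absolute
    value. The other half follows by reflection. *)
Lemma bpoly_even_bound (m : nat) (u : R) :
  (1 <= m)%nat -> 0 <= u <= 1 -> Rabs (bpoly (2 * m) u) <= Rabs (beta (2 * m)).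
Proof.
intros Hm.
assert (Hhalf : forall u, 0 <= u <= 1 / 2 -> Rabs (bpoly (2 * m) u) <= Rabs (beta (2 * m))).
{ clear u; intros u Hu. destruct m as [|m]; [lia|].
  assert (Hs : Rabs ((-1) ^ S m) = 1) by apply pow_1_abs.
  assert (Hm' : forall x, Rabs x = Rabs ((-1) ^ S m * x)) by (intros; rewrite Rabs_mult, Hs; ring).
  rewrite Hm', (Hm' (beta _)).
  assert (Hp : 0 <= 2 / 2 ^ (2 * S m) <= 1).
  { assert (Hp1 := pow_R1_Rle 2 (2 * m) ltac:(lra)).
    replace (2 * S m)%nat with (S (S (2 * m))) by lia. cbn [pow].
    assert (0 < 2 ^ (2 * m)) by lra.
    split; [apply Rlt_le, Rdiv_lt_0_compat; lra|apply Rle_div_l; lra]. }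
  assert (Hh := bpoly_half (2 * S m)).
  assert (H0 := bpoly_at_0 (2 * S m)).
  assert (Hbase := bpoly_even_increasing m 0 (1 / 2) ltac:(lra) ltac:(lra) ltac:(lra)).
  rewrite Hh, H0 in Hbase.
  set (b := beta (2 * S m)) in *. set (s := (-1) ^ S m) in *. set (q := 2 / 2 ^ (2 * S m)) in *.
  assert (Hneg : s * b < 0) by nra.
  assert (L : s * b <= s * bpoly (2 * S m) u).
  { destruct (Req_dec u 0) as [->|Hn]; [rewrite H0; lra|].
    rewrite <- H0. left; apply bpoly_even_increasing; lra. }
  assert (U : s * bpoly (2 * S m) u <= s * ((q - 1) * b)).
  { destruct (Req_dec u (1 / 2)) as [->|Hn]; [rewrite Hh; lra|].
    rewrite <- Hh. left; apply bpoly_even_increasing; lra. }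
  rewrite (Rabs_left (s * b)) by easy. apply Rabs_le. nra. }
intros Hu. destruct (Rle_dec u (1 / 2)) as [h|h]; [apply Hhalf; lra|].
replace u with (1 - (1 - u)) by ring.
rewrite bpoly_reflect, pow_m1_even, Rmult_1_l. apply Hhalf; lra.
Qed.

(** * Decay of the Bernoulli numbers *)

(** The Gram matrix of the Bernoulli polynomials on the unit interval. Its entries are
    again Bernoulli numbers ([bprod_eq]), so inequalities between inner products become
    inequalities between Bernoulli numbers. *)
Definition bprod (i j : nat) : R := RInt (fun u => bpoly i u * bpoly j u) 0 1.

Lemma continuous_bprod (i j : nat) (u : R) :
  continuous (fun u => bpoly i u * bpoly j u) u.
Proof. apply (continuous_mult (bpoly i) (bpoly j)); apply continuous_bpoly. Qed.

Lemma is_RInt_bprod (i j : nat) :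
  is_RInt (fun u => bpoly i u * bpoly j u) 0 1 (bprod i j).
Proof.
apply (RInt_correct (V := R_CompleteNormedModule)),
  (ex_RInt_continuous (V := R_CompleteNormedModule)).
intros; apply continuous_bprod.
Qed.

Lemma bprod_parts (i j : nat) :
  bprod (S i) j + bprod i (S j)
  = bpoly (S i) 1 * bpoly (S j) 1 - bpoly (S i) 0 * bpoly (S j) 0.
Proof.
apply (is_RInt_inj (fun u => bpoly (S i) u * bpoly j u + bpoly i u * bpoly (S j) u) 0 1).
- apply (is_RInt_plus (V := R_NormedModule)); apply is_RInt_bprod.
- apply (ftc (fun u => bpoly (S i) u * bpoly (S j) u)).
  + intros x. eapply der_eq; [apply der_mult; apply is_derive_bpoly|ring].
  + intros x. apply (continuous_plus (V := R_NormedModule)); apply continuous_bprod.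
Qed.

(** Integration by parts moves a derivative from one factor to the other until the first
    factor is [bpoly 1], whose jump of [1] between the ends produces the value. *)
Lemma bprod_eq (i j : nat) :
  (1 <= j)%nat -> bprod (S i) j = (-1) ^ i * beta (S i + j).
Proof.
revert j; induction i as [|i IH]; intros j Hj; destruct j as [|j]; try lia.
- assert (H := bprod_parts 0 (S j)).
  assert (H1 := bprod_parts 1 (S j)).
  assert (Z : bprod 0 (S (S j)) = 0).
  { apply (is_RInt_inj (fun u => bpoly 0 u * bpoly (S (S j)) u) 0 1); [apply is_RInt_bprod|].
    apply is_RInt_ext with (bpoly (S (S j))); [intros; rewrite bpoly_0; as_R; ring|].
    replace 0 with (bpoly (S (S (S j))) 1 - bpoly (S (S (S j))) 0) at 2
      by (rewrite bpoly_at_1, bpoly_at_0; ring).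
    apply ftc; [apply is_derive_bpoly|apply continuous_bpoly]. }
  rewrite Z, bpoly_at_1, !bpoly_at_0 in H.
  replace (bpoly 1 1) with (1 / 2) in H.
  2: { unfold bpoly, beta; rewrite sum_Sn, sum_O, bernoulli_0, bernoulli_1; unfold plus; cbn;
    field. }
  replace (beta 1) with (- (1 / 2)) in H by (unfold beta; rewrite bernoulli_1; cbn; field).
  cbn [pow]. change (1 + S j)%nat with (S (S j)). lra.
- assert (H := bprod_parts (S i) (S j)). rewrite IH in H by lia.
  rewrite !bpoly_at_1, !bpoly_at_0 in H.
  replace (S (S i) + S j)%nat with (S i + S (S j))%nat by lia. cbn [pow]. lra.
Qed.

(** Integrating the square of [a * bpoly i + b * bpoly j] gives a nonnegative quadratic
    form in [a] and [b]. *)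
Lemma bprod_cauchy (i j : nat) : bprod i j ^ 2 <= bprod i i * bprod j j.
Proof.
assert (Q : forall a b, 0 <= a ^ 2 * bprod i i + 2 * a * b * bprod i j + b ^ 2 * bprod j j).
{ intros a b.
  assert (H : is_RInt (fun u => (a * bpoly i u + b * bpoly j u) ^ 2) 0 1
    (a ^ 2 * bprod i i + 2 * a * b * bprod i j + b ^ 2 * bprod j j)).
  { apply is_RInt_ext with (fun u => a ^ 2 * (bpoly i u * bpoly i u)
      + 2 * a * b * (bpoly i u * bpoly j u) + b ^ 2 * (bpoly j u * bpoly j u)).
    { intros; as_R; ring. }
    apply rint_plus; [apply rint_plus|]; apply rint_scal, is_RInt_bprod. }
  apply (is_RInt_le (fun _ => 0) _ 0 1 0 _ ltac:(lra)
    ltac:(evar_last; [apply (is_RInt_const (V := R_NormedModule))|unfold scal; cbn; unfold mult;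
      cbn; ring]) H).
  intros; apply pow2_ge_0. }
assert (Qa := Q 1 0). assert (Qb := Q 0 1).
assert (Q1 := Q (bprod j j) (- bprod i j)). assert (Q2 := Q (bprod i j) (- bprod i i)).
destruct (Rle_lt_or_eq_dec 0 (bprod j j)) as [h|h]; [lra| |].
- nra.
- destruct (Rle_lt_or_eq_dec 0 (bprod i i)) as [h'|h']; [lra|nra|].
  rewrite <- h, <- h' in *. assert (Q3 := Q 1 1). assert (Q4 := Q 1 (-1)). nra.
Qed.

Lemma beta_even_pos (m : nat) : 0 < (-1) ^ m * beta (2 * S m).
Proof.
assert (H := bpoly_even_increasing m 0 (1 / 2) ltac:(lra) ltac:(lra) ltac:(lra)).
rewrite bpoly_half, bpoly_at_0 in H.
assert (Hp : 0 < 2 / 2 ^ (2 * S m) <= 1).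
{ assert (Hp1 := pow_R1_Rle 2 (2 * m) ltac:(lra)).
  replace (2 * S m)%nat with (S (S (2 * m))) by lia. cbn [pow].
  split; [apply Rdiv_lt_0_compat; lra|apply Rle_div_l; lra]. }
cbn [pow] in H. set (b := beta (2 * S m)) in *. set (s := (-1) ^ m) in *.
change ((1 + 1) * 2 ^ (m + S (m + 0))) with (2 ^ (2 * S m)) in *.
set (q := 2 / _) in *. nra.
Qed.

(** Cauchy-Schwarz for two polynomials whose indices differ by two. *)
Lemma beta_even_log_convex (m : nat) :
  beta (2 * S (S m)) ^ 2 <= Rabs (beta (2 * S m)) * Rabs (beta (2 * S (S (S m)))).
Proof.
assert (H := bprod_cauchy (S m) (S (S (S m)))).
rewrite !bprod_eq in H by lia.
replace (S m + S m)%nat with (2 * S m)%nat in H by lia.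
replace (S m + S (S (S m)))%nat with (2 * S (S m))%nat in H by lia.
replace (S (S (S m)) + S (S (S m)))%nat with (2 * S (S (S m)))%nat in H by lia.
assert (Hs : ((-1) ^ m) ^ 2 = 1) by (rewrite <- pow_mult, Nat.mul_comm; apply pow_m1_even).
rewrite Rpow_mult_distr, Hs in H.
eapply Rle_trans; [|eapply Rle_trans; [exact H|]]; [lra|].
apply Rmult_le_compat.
- left; apply beta_even_pos.
- left; apply (beta_even_pos (S (S m))).
- rewrite <- (Rmult_1_l (Rabs _)), <- (pow_1_abs m), <- Rabs_mult. apply Rle_abs.
- rewrite <- (Rmult_1_l (Rabs _)), <- (pow_1_abs (S (S m))), <- Rabs_mult. apply Rle_abs.
Qed.

(** The cubic Taylor polynomial is a lower bound for the sine; the slope one third is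
    far from sharp, but positive. *)
Lemma sin_ge_third (x : R) : 0 <= x <= 2 -> x / 3 <= sin x.
Proof.
intros Hx. destruct (pre_sin_bound x 0) as [H _]; try lra.
unfold sin_approx in H; cbn [sum_f_R0 Nat.mul Nat.add] in H.
unfold sin_term in H; cbn in H. nra.
Qed.

Lemma bpoly_3 (u : R) : bpoly 3 u = u * (1 / 2 - u) * (1 - u) / 6.
Proof.
unfold bpoly, beta; rewrite !sum_Sn, sum_O, bernoulli_0, bernoulli_1, bernoulli_2, bernoulli_3.
unfold plus; cbn; field.
Qed.

Lemma bpoly_3_le_sin (u : R) : 0 <= u <= 1 / 2 -> 0 <= bpoly 3 u <= sin (2 * PI * u).
Proof.
intros Hu. rewrite bpoly_3.
assert (P4 := PI_4). assert (P2 := PI2_1).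
assert (H1 : PI * u / 3 <= sin (PI * u)) by (apply sin_ge_third; nra).
assert (H2 : PI * (1 / 2 - u) / 3 <= sin (PI / 2 - PI * u)).
{ replace (PI / 2 - PI * u) with (PI * (1 / 2 - u)) by field. apply sin_ge_third; nra. }
rewrite sin_shift in H2.
replace (2 * PI * u) with (2 * (PI * u)) by ring. rewrite sin_2a.
assert (0 <= u * (1 / 2 - u)) by nra.
split; [nra|].
assert (PI * u / 3 * (PI * (1 / 2 - u) / 3) <= sin (PI * u) * cos (PI * u)) by
  (apply Rmult_le_compat; nra).
assert (4 * (u * (1 / 2 - u)) <= PI * PI * (u * (1 / 2 - u)))
  by (apply Rmult_le_compat_r; nra).
assert (u * (1 / 2 - u) * (1 - u) <= u * (1 / 2 - u) * 1) by (apply Rmult_le_compat_l; lra).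
lra.
Qed.

Lemma is_derive_sin_lin (c u : R) : is_derive (fun u => sin (c * u)) u (c * cos (c * u)).
Proof. auto_derive; [easy|ring]. Qed.

Lemma is_derive_cos_lin (c u : R) : is_derive (fun u => cos (c * u)) u (- c * sin (c * u)).
Proof. auto_derive; [easy|ring]. Qed.

Lemma continuous_bpoly_sin (n : nat) (c u : R) : continuous (fun u => bpoly n u * sin (c * u)) u.
Proof.
apply (continuous_mult (bpoly n) (fun u => sin (c * u))); [apply continuous_bpoly|].
apply (ex_derive_continuous (K := R_AbsRing) (V := R_NormedModule)).
eexists; apply is_derive_sin_lin.
Qed.

(** The first Fourier coefficient. Two integrations by parts divide it by
    [- (2 * PI) ^ 2] and raise the index by two, the boundary terms cancelling by
    periodicity. *)
Lemma bpoly_sin_coefficient (k : nat) :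
  is_RInt (fun u => bpoly (2 * k + 1) u * sin (2 * PI * u)) 0 1
    ((-1) ^ S k / (2 * PI) ^ (2 * k + 1)).
Proof.
assert (Hpi := PI_RGT_0). set (c := 2 * PI). assert (Hc : 0 < c) by (unfold c; lra).
assert (Hs : sin (c * 1) = 0) by (rewrite Rmult_1_r; apply sin_2PI).
assert (Hco : cos (c * 1) = 1) by (rewrite Rmult_1_r; apply cos_2PI).
induction k as [|k IH].
- change (2 * 0 + 1)%nat with 1%nat.
  replace ((-1) ^ 1 / c ^ 1) with ((- (1 - 1 / 2) * cos (c * 1) / c + sin (c * 1) / c ^ 2)
    - (- (0 - 1 / 2) * cos (c * 0) / c + sin (c * 0) / c ^ 2)).
  2: { rewrite Hs, Hco, Rmult_0_r, sin_0, cos_0. field; lra. }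
  apply (ftc (fun u => - (u - 1 / 2) * cos (c * u) / c + sin (c * u) / c ^ 2)).
  + intros x. auto_derive; [easy|].
    unfold bpoly, beta; rewrite sum_Sn, sum_O, bernoulli_0, bernoulli_1.
    unfold plus; cbn; field; lra.
  + apply continuous_bpoly_sin.
- replace (2 * S k + 1)%nat with (S (S (2 * k + 1))) by lia.
  set (n := (2 * k + 1)%nat) in *.
  assert (F : is_RInt (fun u => bpoly n u * sin (c * u) + c ^ 2 *
    (bpoly (S (S n)) u * sin (c * u))) 0 1 0).
  { replace 0 with ((bpoly (S n) 1 * sin (c * 1) - c * (bpoly (S (S n)) 1 * cos (c * 1)))
      - (bpoly (S n) 0 * sin (c * 0) - c * (bpoly (S (S n)) 0 * cos (c * 0)))) at 2.
    2: { rewrite Hs, Hco, !Rmult_0_r, sin_0, cos_0, bpoly_at_1, !bpoly_at_0. ring. }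
    apply (ftc (fun u => bpoly (S n) u * sin (c * u) - c * (bpoly (S (S n)) u * cos (c * u)))).
    - intros x. eapply der_eq.
      + apply (der_minus (fun u => bpoly (S n) u * sin (c * u))).
        * apply (der_mult (bpoly (S n))); [apply is_derive_bpoly|apply is_derive_sin_lin].
        * apply der_scal, (der_mult (bpoly (S (S n))));
          [apply is_derive_bpoly|apply is_derive_cos_lin].
      + cbv beta; ring.
    - intros x. apply (continuous_plus (V := R_NormedModule)); [apply continuous_bpoly_sin|].
      apply (continuous_scal_r (V := R_NormedModule) (c ^ 2)), continuous_bpoly_sin. }
  assert (F2 := rint_scal _ (/ c ^ 2) _ _ _ (rint_minus _ _ _ _ _ _ F IH)).
  evar_last; [eapply is_RInt_ext; [|exact F2]|].
  + intros x _. cbv beta. as_R. field; lra.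
  + cbn [pow]. as_R. field. split; [|lra]. apply pow_nonzero; lra.
Qed.

(** By [bprod_eq] this is the integral of [bpoly (2 * k + 1) * bpoly 3]. The first
    factor has the sign pattern of [sin (2 * PI * u)], and [bpoly 3] is dominated by
    that sine, so the integral is at most the first Fourier coefficient. *)
Lemma beta_even_upper (k : nat) : Rabs (beta (2 * S (S k))) <= / (2 * PI) ^ (2 * k + 1).
Proof.
assert (Hpi := PI_RGT_0).
assert (HI := rint_scal _ ((-1) ^ S k) _ _ _ (is_RInt_bprod (2 * k + 1) 3)).
assert (HS := rint_scal _ ((-1) ^ S k) _ _ _ (bpoly_sin_coefficient k)).
assert (Hsq : (-1) ^ S k * (-1) ^ S k = 1).
{ rewrite <- Rpow_mult_distr. replace (-1 * -1) with 1 by ring. apply pow1. }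
assert (Hm : (-1) ^ S k * beta (2 * S (S k)) <= / (2 * PI) ^ (2 * k + 1)).
{ assert (L := is_RInt_le _ _ 0 1 _ _ ltac:(lra) HI HS).
  replace (bprod (2 * k + 1) 3) with (beta (2 * S (S k))) in L.
  2: { replace (2 * k + 1)%nat with (S (2 * k)) by lia. rewrite bprod_eq, pow_m1_even by lia.
       rewrite Rmult_1_l. f_equal; lia. }
  eapply Rle_trans; [apply L|].
  - intros u Hu.
    assert (Key : forall v, 0 <= v <= 1 / 2 ->
      (-1) ^ S k * (bpoly (2 * k + 1) v * bpoly 3 v) <= (-1) ^ S k *
        (bpoly (2 * k + 1) v * sin (2 * PI * v))).
    { intros v Hv. rewrite <- !Rmult_assoc. apply Rmult_le_compat_l; [|now apply bpoly_3_le_sin].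
      destruct (Req_dec v 0) as [->|]; [|destruct (Req_dec v (1 / 2)) as [->|]].
      - rewrite bpoly_at_0. destruct k as [|k]; [|rewrite beta_odd by lia; lra].
        unfold beta; cbn [Nat.mul Nat.add]. rewrite bernoulli_1; cbn; lra.
      - rewrite bpoly_odd_half; lra.
      - left; apply bpoly_odd_sign; lra. }
    destruct (Rle_dec u (1 / 2)) as [h|h]; [apply Key; lra|].
    specialize (Key (1 - u) ltac:(lra)).
    rewrite !bpoly_reflect, pow_m1_odd in Key.
    replace (2 * PI * (1 - u)) with (- (2 * PI * u) + 2 * PI) in Key by ring.
    rewrite sin_plus, sin_2PI, cos_2PI, sin_neg in Key. cbn [pow] in *. lra.
  - right. unfold Rdiv. rewrite <- Rmult_assoc.
    change (-1 * (-1) ^ k) with ((-1) ^ S k). rewrite Hsq; apply Rmult_1_l. }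
assert (P := beta_even_pos (S k)).
assert (Hs : Rabs ((-1) ^ S k) = 1) by apply pow_1_abs.
rewrite <- (Rmult_1_l (Rabs _)), <- Hs, <- Rabs_mult, Rabs_right; lra.
Qed.

(** The ratio of consecutive terms is nondecreasing; one ratio above [1] would force
    geometric growth. *)
Lemma log_convex_bounded_decr (a : nat -> R) (M : R) :
  (forall n, 0 < a n) -> (forall n, a (S n) ^ 2 <= a n * a (S (S n))) ->
  (forall n, a n <= M) -> forall n, a (S n) <= a n.
Proof.
intros Hpos Hlc HM n. apply Rnot_lt_le; intros Hlt.
set (d := a (S n) / a n - 1).
assert (Hn := Hpos n).
assert (Hd : 0 < d).
{ unfold d. apply Rlt_Rminus, Rlt_div_r; lra. }
assert (Hr : forall j, (1 + d) * a (n + j)%nat <= a (S (n + j))).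
{ induction j as [|j IH].
  - rewrite Nat.add_0_r. right. unfold d; field; lra.
  - rewrite Nat.add_succ_r. specialize (Hlc (n + j)%nat).
    assert (h1 := Hpos (n + j)%nat). assert (h2 := Hpos (S (n + j))).
    apply (Rmult_le_reg_l (a (n + j)%nat)); [easy|]. nra. }
assert (Hg : forall j, a n * (1 + INR j * d) <= a (n + j)%nat).
{ induction j as [|j IH].
  - rewrite Nat.add_0_r; cbn; lra.
  - rewrite Nat.add_succ_r, S_INR. specialize (Hr j). assert (0 <= INR j) by apply pos_INR.
    assert (0 <= INR j * d * d * a n) by (repeat apply Rmult_le_pos; lra). nra. }
destruct (INR_unbounded (M / (a n * d))) as [j Hj].
specialize (Hg j). specialize (HM (n + j)%nat).
apply Rlt_div_l in Hj; [|nra]. nra.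
Qed.

(** The sequence [|beta (2 * n)| * (2 * PI) ^ (2 * n)] is twice the zeta value at
    [2 * n]; that it decreases follows from log-convexity and boundedness. *)
Lemma beta_even_ratio (m : nat) :
  (1 <= m)%nat -> Rabs (beta (2 * S m)) * (4 * PI ^ 2) <= Rabs (beta (2 * m)).
Proof.
intros Hm. destruct m as [|m]; [lia|]. clear Hm.
assert (Hpi := PI_RGT_0). set (c := 2 * PI).
assert (Hc : 0 < c) by (unfold c; lra).
set (a := fun n => Rabs (beta (2 * S n)) * c ^ (2 * n)).
assert (Hpos : forall n, 0 < a n).
{ intros n; apply Rmult_lt_0_compat; [|now apply pow_lt].
  apply Rabs_pos_lt, beta_even_neq_0; lia. }
assert (Hdec : a (S m) <= a m).
{ apply (log_convex_bounded_decr a (c + a 0%nat)); [easy| |].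
  - intros n. unfold a.
    assert (Hq2 : c ^ (2 * S n) = c ^ (2 * n) * c ^ 2) by (rewrite <- pow_add; f_equal; lia).
    assert (Hq4 : c ^ (2 * S (S n)) = c ^ (2 * n) * c ^ 4) by (rewrite <- pow_add; f_equal; lia).
    rewrite Hq2, Hq4.
    assert (H := beta_even_log_convex n). rewrite <- pow2_abs in H.
    set (x := Rabs (beta (2 * S (S n)))) in *. set (y := Rabs (beta (2 * S n))) in *.
    set (z := Rabs (beta (2 * S (S (S n))))) in *. set (q := c ^ (2 * n)).
    replace ((x * (q * c ^ 2)) ^ 2) with (x ^ 2 * (q ^ 2 * c ^ 4)) by ring.
    replace (y * q * (z * (q * c ^ 4))) with (y * z * (q ^ 2 * c ^ 4)) by ring.
    apply Rmult_le_compat_r; [|easy]. apply Rmult_le_pos; apply pow_le; [|lra].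
    now apply Rlt_le, pow_lt.
  - intros [|n]; [lra|]. assert (H := beta_even_upper n). fold c in H.
    assert (H0 := Hpos 0%nat). enough (a (S n) <= c) by lra. unfold a.
    replace (c ^ (2 * S n)) with (c ^ (2 * n + 1) * c ^ 1) by (rewrite <- pow_add; f_equal; lia).
    assert (Hq : 0 < c ^ (2 * n + 1)) by now apply pow_lt.
    set (q := c ^ (2 * n + 1)) in *.
    apply (Rmult_le_compat_r (q * c ^ 1)) in H; [|rewrite pow_1; nra].
    eapply Rle_trans; [exact H|]. right; field; lra. }
unfold a in Hdec.
replace (c ^ (2 * S m)) with (c ^ (2 * m) * c ^ 2) in Hdec by (rewrite <- pow_add; f_equal; lia).
assert (Hq : 0 < c ^ (2 * m)) by now apply pow_lt.
apply (Rmult_le_reg_r (c ^ (2 * m))); [easy|].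
replace (4 * PI ^ 2) with (c ^ 2) by (unfold c; ring). lra.
Qed.

(** * Complex-valued functions of a real variable *)

(** Derivatives, integrals and limits of complex functions are taken on real and
    imaginary parts. This keeps every analytic argument inside real analysis, where one
    theory of derivatives is available for both products and quotients. *)
Definition Cder (f : R -> C) (x : R) (l : C) : Prop :=
  is_derive (fun t => Re (f t)) x (Re l) /\ is_derive (fun t => Im (f t)) x (Im l).

Lemma Cder_eq (f : R -> C) (x : R) (a b : C) : Cder f x a -> a = b -> Cder f x b.
Proof. now intros H <-. Qed.

Lemma Cder_const (c : C) (x : R) : Cder (fun _ => c) x 0.
Proof. split; [apply (der_const (Re c))|apply (der_const (Im c))]. Qed.

Lemma Cder_RtoC (f : R -> R) (x a : R) : is_derive f x a -> Cder (fun t => RtoC (f t)) x (RtoC a).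
Proof.
intros H; split.
- change (is_derive f x a); exact H.
- exact (der_const 0 x).
Qed.

Lemma Cder_plus (f g : R -> C) (x : R) (a b : C) :
  Cder f x a -> Cder g x b -> Cder (fun t => f t + g t)%C x (a + b)%C.
Proof.
intros [H1 H2] [H3 H4]; split.
- exact (der_plus _ _ _ _ _ H1 H3).
- exact (der_plus _ _ _ _ _ H2 H4).
Qed.

Lemma Cder_minus (f g : R -> C) (x : R) (a b : C) :
  Cder f x a -> Cder g x b -> Cder (fun t => f t - g t)%C x (a - b)%C.
Proof.
intros [H1 H2] [H3 H4]; split.
- exact (der_minus _ _ _ _ _ H1 H3).
- exact (der_minus _ _ _ _ _ H2 H4).
Qed.

Lemma Cder_mult (f g : R -> C) (x : R) (a b : C) :
  Cder f x a -> Cder g x b -> Cder (fun t => f t * g t)%C x (a * g x + f x * b)%C.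
Proof.
intros [H1 H2] [H3 H4]; split.
- eapply der_eq.
  + exact (der_minus _ _ _ _ _ (der_mult _ _ _ _ _ H1 H3) (der_mult _ _ _ _ _ H2 H4)).
  + unfold Re, Im; cbn; ring.
- eapply der_eq.
  + exact (der_plus _ _ _ _ _ (der_mult _ _ _ _ _ H1 H4) (der_mult _ _ _ _ _ H2 H3)).
  + unfold Re, Im; cbn; ring.
Qed.

Lemma Cder_scal (c : C) (f : R -> C) (x : R) (a : C) :
  Cder f x a -> Cder (fun t => c * f t)%C x (c * a)%C.
Proof.
intros H. eapply Cder_eq; [apply (Cder_mult (fun _ => c)); [apply Cder_const|exact H]|ring].
Qed.

Lemma C_sq_norm_neq_0 (z : C) : z <> 0 -> Re z ^ 2 + Im z ^ 2 <> 0.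
Proof.
intros Hz E. apply Hz. destruct z as [a b]; cbn in E.
apply injective_projections; cbn; nra.
Qed.

Lemma C_eq_div (a b c : C) : b <> 0 -> (a * b)%C = c -> a = (c / b)%C.
Proof. intros Hb <-. field; easy. Qed.

Lemma Cder_inv (f : R -> C) (x : R) (a : C) :
  f x <> 0 -> Cder f x a -> Cder (fun t => / f t)%C x (- a / (f x) ^ 2)%C.
Proof.
intros Hf [H1 H2]. assert (Hn := C_sq_norm_neq_0 _ Hf).
set (p := fun t => Re (f t)) in *. set (q := fun t => Im (f t)) in *.
change (Re (f x)) with (p x) in Hn. change (Im (f x)) with (q x) in Hn.
assert (E1 : ex_derive p x) by (eexists; exact H1).
assert (E2 : ex_derive q x) by (eexists; exact H2).
assert (D1 : Derive p x = Re a) by exact (is_derive_unique _ _ _ H1).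
assert (D2 : Derive q x = Im a) by exact (is_derive_unique _ _ _ H2).
replace (- a / (f x) ^ 2)%C with
  ((Re a * (q x ^ 2 - p x ^ 2) - 2 * p x * q x * Im a) / (p x ^ 2 + q x ^ 2) ^ 2,
   (2 * p x * q x * Re a - Im a * (p x ^ 2 - q x ^ 2)) / (p x ^ 2 + q x ^ 2) ^ 2).
2: { rewrite (surjective_pairing (f x)), (surjective_pairing a).
  fold (Re (f x)) (Im (f x)) (Re a) (Im a). fold (p x) (q x).
  generalize dependent (p x). generalize (q x). intros v u Hn.
  assert (Hz : (u, v) <> RtoC 0) by (intros h; injection h; intros -> ->; apply Hn; ring).
  apply C_eq_div; [now apply Cpow_nz|].
  cbn [Cpow]. rewrite Cmult_1_r.
  apply injective_projections; cbn; field; intros h; apply Hn; rewrite <- h; ring. }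
split; cbn [Re Im fst snd].
- change (fun t => Re (/ f t)) with (fun t => p t / (p t ^ 2 + q t ^ 2)).
  auto_derive; [auto|].
  change (Derive (fun x0 : R => p x0) x) with (Derive p x).
    change (Derive (fun x0 : R => q x0) x) with (Derive q x).
  rewrite D1, D2. field; intros h; apply Hn; rewrite <- h; ring.
- change (fun t => Im (/ f t)) with (fun t => - q t / (p t ^ 2 + q t ^ 2)).
  auto_derive; [auto|].
  change (Derive (fun x0 : R => p x0) x) with (Derive p x).
    change (Derive (fun x0 : R => q x0) x) with (Derive q x).
  rewrite D1, D2. field; intros h; apply Hn; rewrite <- h; ring.
Qed.

Lemma Cder_pow (f : R -> C) (n : nat) (x : R) (a : C) :
  Cder f x a -> Cder (fun t => f t ^ S n)%C x (INR (S n) * a * f x ^ n)%C.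
Proof.
intros H. induction n as [|n IH].
- eapply Cder_eq; [exact (Cder_mult f (fun _ => RtoC 1) x _ _ H (Cder_const 1 x))|].
  cbn [INR Cpow]. ring.
- eapply Cder_eq; [exact (Cder_mult f (fun t => f t ^ S n)%C x _ _ H IH)|].
  rewrite (S_INR (S n)), RtoC_plus, !Cpow_S. ring.
Qed.

Lemma Cder_inv_pow (f : R -> C) (n : nat) (x : R) (a : C) :
  f x <> 0 -> Cder f x a ->
  Cder (fun t => / (f t) ^ n)%C x (- INR n * a / (f x) ^ S n)%C.
Proof.
intros Hf H. destruct n as [|n].
- eapply Cder_eq; [exact (Cder_const (/ 1)%C x)|]. cbn [INR]. rewrite Cpow_1_r. field; easy.
- eapply Cder_eq.
  + exact (Cder_inv (fun t => f t ^ S n)%C x _ (Cpow_nz _ _ Hf) (Cder_pow f n x a H)).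
  + rewrite !Cpow_S. field. split; [now apply Cpow_nz|easy].
Qed.

(** With [r = |f|] and [p], [q] the parts of [f], the half-angle form of the argument
    satisfies [(r + p) ^ 2 + q ^ 2 = 2 * r * (r + p)], which collapses its derivative to
    that of the usual arctangent. *)
Lemma Cder_Clog (f : R -> C) (x : R) (a : C) :
  slit_plane (f x) -> Cder f x a -> Cder (fun t => Clog (f t)) x (a / f x)%C.
Proof.
intros Hs [H1 H2]. assert (Hp := slit_plane_pos _ Hs).
set (p := fun t => Re (f t)) in *. set (q := fun t => Im (f t)) in *.
assert (E1 : ex_derive p x) by (eexists; exact H1).
assert (E2 : ex_derive q x) by (eexists; exact H2).
assert (D1 : Derive p x = Re a) by exact (is_derive_unique _ _ _ H1).
assert (D2 : Derive q x = Im a) by exact (is_derive_unique _ _ _ H2).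
assert (Hn : 0 < p x ^ 2 + q x ^ 2).
{ assert (H : f x <> 0).
  { intros h; apply Hs; rewrite h; cbn; lra. }
  apply C_sq_norm_neq_0 in H. fold (p x) (q x) in H. change (Re (f x)) with (p x) in H.
    change (Im (f x)) with (q x) in H. nra. }
set (r := sqrt (p x ^ 2 + q x ^ 2)).
assert (Hr : 0 < r) by now apply sqrt_lt_R0.
assert (Hr2 : r * r = p x ^ 2 + q x ^ 2) by (apply sqrt_sqrt; lra).
change (0 < r + p x) in Hp.
assert (Ea : (a / f x)%C = ((Re a * p x + Im a * q x) / (r * r), (Im a * p x - Re a * q x) /
  (r * r))).
{ rewrite Hr2. rewrite (surjective_pairing (f x)), (surjective_pairing a).
  fold (Re (f x)) (Im (f x)) (Re a) (Im a). fold (p x) (q x).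
  change (Re (f x)) with (p x). change (Im (f x)) with (q x).
  apply injective_projections; cbn; field; nra. }
rewrite Ea. split; cbn [Re Im fst snd].
- change (fun t => Re (Clog (f t))) with (fun t => ln (sqrt (p t ^ 2 + q t ^ 2))).
  auto_derive; [fold r; replace (p x * (p x * 1) + q x * (q x * 1)) with (p x ^ 2 + q x ^ 2) by
    ring; auto|].
  change (Derive (fun x0 : R => p x0) x) with (Derive p x).
    change (Derive (fun x0 : R => q x0) x) with (Derive q x).
  rewrite D1, D2.
  replace (p x * (p x * 1) + q x * (q x * 1)) with (p x ^ 2 + q x ^ 2) by ring.
  fold r. field; lra.
- change (fun t => Im (Clog (f t))) with (fun t => 2 * atan
  (q t / (sqrt (p t ^ 2 + q t ^ 2) + p t))).
  auto_derive; replace (p x * (p x * 1) + q x * (q x * 1)) with (p x ^ 2 + q x ^ 2) by ring; fold r.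
  + repeat split; auto; lra.
  + change (Derive (fun x0 : R => p x0) x) with (Derive p x).
    change (Derive (fun x0 : R => q x0) x) with (Derive q x).
    rewrite D1, D2.
    assert (Hd : (r + p x) ^ 2 + q x ^ 2 = 2 * r * (r + p x)) by nra.
    assert (Hd0 : 0 < (r + p x) ^ 2 + q x ^ 2) by (rewrite Hd; nra).
    transitivity (2 * (Im a * (r + p x) - q x * ((Re a * p x + Im a * q x) / r + Re a)) /
      ((r + p x) ^ 2 + q x ^ 2)).
    * field. repeat split; try lra; nra.
    * rewrite Hd.
      replace (2 * (Im a * (r + p x) - q x * ((Re a * p x + Im a * q x) / r + Re a)) /
        (2 * r * (r + p x)))
       with ((Im a * (r * r - q x ^ 2 + r * p x) - q x * Re a * (p x + r)) / (r * r * (r + p x)))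
         by (field; lra).
      rewrite Hr2 at 1. field; lra.
Qed.

Definition is_cint (f : R -> C) (a b : R) (l : C) : Prop :=
  is_RInt (fun t => Re (f t)) a b (Re l) /\ is_RInt (fun t => Im (f t)) a b (Im l).

Definition Ccont (f : R -> C) (x : R) : Prop :=
  continuous (fun t => Re (f t)) x /\ continuous (fun t => Im (f t)) x.

Lemma Cder_Ccont (f : R -> C) (x : R) (a : C) : Cder f x a -> Ccont f x.
Proof.
intros [H1 H2]; split; apply (ex_derive_continuous (K := R_AbsRing) (V := R_NormedModule));
  eexists; eassumption.
Qed.

Lemma Ccont_mult (f g : R -> C) (x : R) :
  Ccont f x -> Ccont g x -> Ccont (fun t => f t * g t)%C x.
Proof.
intros [H1 H2] [H3 H4]; split.
- apply (continuous_minus (V := R_NormedModule) (fun t => Re (f t) * Re (g t))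
  (fun t => Im (f t) * Im (g t)));
  now apply (continuous_mult (K := R_AbsRing)).
- apply (continuous_plus (V := R_NormedModule) (fun t => Re (f t) * Im (g t))
  (fun t => Im (f t) * Re (g t)));
  now apply (continuous_mult (K := R_AbsRing)).
Qed.

Lemma Ccont_RtoC (f : R -> R) (x : R) : continuous f x -> Ccont (fun t => RtoC (f t)) x.
Proof. intros H; split; [exact H|apply continuous_const]. Qed.

Lemma is_cint_minus (f g : R -> C) (a b : R) (lf lg : C) :
  is_cint f a b lf -> is_cint g a b lg -> is_cint (fun t => f t - g t)%C a b (lf - lg)%C.
Proof. intros [H1 H2] [H3 H4]; split; now apply rint_minus. Qed.

Lemma is_cint_scal (c : C) (f : R -> C) (a b : R) (l : C) :
  is_cint f a b l -> is_cint (fun t => c * f t)%C a b (c * l)%C.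
Proof.
intros [H1 H2]; split.
- apply (rint_minus (fun t => Re c * Re (f t)) (fun t => Im c * Im (f t))); now apply rint_scal.
- apply (rint_plus (fun t => Re c * Im (f t)) (fun t => Im c * Re (f t))); now apply rint_scal.
Qed.

Lemma is_cint_inj (f : R -> C) (a b : R) (l1 l2 : C) :
  is_cint f a b l1 -> is_cint f a b l2 -> l1 = l2.
Proof.
intros [H1 H2] [H3 H4]. apply injective_projections.
- exact (is_RInt_inj _ _ _ _ _ H1 H3).
- exact (is_RInt_inj _ _ _ _ _ H2 H4).
Qed.

Lemma is_cint_ftc (f df : R -> C) (a b : R) :
  a <= b -> (forall x, a <= x <= b -> Cder f x (df x)) ->
  (forall x, a <= x <= b -> Ccont df x) -> is_cint df a b (f b - f a)%C.
Proof.
intros Hab Hd Hc. split.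
- apply (is_RInt_derive (V := R_CompleteNormedModule) (fun t => Re (f t)) (fun t => Re (df t)));
  rewrite Rmin_left, Rmax_right by easy; intros x Hx; [now apply Hd|now apply Hc].
- apply (is_RInt_derive (V := R_CompleteNormedModule) (fun t => Im (f t)) (fun t => Im (df t)));
  rewrite Rmin_left, Rmax_right by easy; intros x Hx; [now apply Hd|now apply Hc].
Qed.

Lemma is_cint_bound (f : R -> C) (g : R -> R) (a b : R) (l : C) (lg : R) :
  a <= b -> (forall x, a <= x <= b -> Cmod (f x) <= g x) ->
  is_cint f a b l -> is_RInt g a b lg -> Cmod l <= lg.
Proof.
intros Hab Hb [H1 H2] Hg.
assert (Hf : is_RInt (V := C_R_NormedModule) f a b l).
{ rewrite (surjective_pairing l).
  apply (is_RInt_fct_extend_pair (U := R_NormedModule) (V := R_NormedModule) f a b); assumption. }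
rewrite Cmod_norm.
apply (norm_RInt_le (V := C_R_NormedModule) f g a b l lg Hab); auto.
intros x Hx. eapply Rle_trans; [|exact (Hb x Hx)]. rewrite Cmod_norm. now right.
Qed.

Lemma is_cint_exists (f : R -> C) (a b : R) :
  a <= b -> (forall x, a <= x <= b -> Ccont f x) ->
  is_cint f a b (RInt (fun t => Re (f t)) a b, RInt (fun t => Im (f t)) a b).
Proof.
intros Hab Hc; split; apply (RInt_correct (V := R_CompleteNormedModule)),
  (ex_RInt_continuous (V := R_CompleteNormedModule)); intros x Hx;
  rewrite Rmin_left, Rmax_right in Hx by easy; now apply Hc.
Qed.

(** * Limits of complex sequences *)

Lemma Im_abs_le_Cmod (z : C) : Rabs (Im z) <= Cmod z.
Proof.
apply Rabs_le. assert (h := Cmod2_alt z). assert (h0 := Cmod_ge_0 z). split; nra.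
Qed.

Lemma RtoC_neq (a b : R) : a <> b -> RtoC a <> RtoC b.
Proof. intros H h; apply H; now injection h. Qed.

Definition is_Clim (u : nat -> C) (l : C) : Prop :=
  is_lim_seq (fun n => Re (u n)) (Re l) /\ is_lim_seq (fun n => Im (u n)) (Im l).

Lemma is_Clim_const (c : C) : is_Clim (fun _ => c) c.
Proof. split; apply is_lim_seq_const. Qed.

Lemma is_Clim_plus (u v : nat -> C) (a b : C) :
  is_Clim u a -> is_Clim v b -> is_Clim (fun n => u n + v n)%C (a + b)%C.
Proof. intros [H1 H2] [H3 H4]; split; now apply is_lim_seq_plus'. Qed.

Lemma is_Clim_minus (u v : nat -> C) (a b : C) :
  is_Clim u a -> is_Clim v b -> is_Clim (fun n => u n - v n)%C (a - b)%C.
Proof. intros [H1 H2] [H3 H4]; split; now apply is_lim_seq_minus'. Qed.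

Lemma is_Clim_scal (c : C) (u : nat -> C) (a : C) :
  is_Clim u a -> is_Clim (fun n => c * u n)%C (c * a)%C.
Proof.
intros [H1 H2]; split.
- apply (is_lim_seq_minus' (fun n => Re c * Re (u n)) (fun n => Im c * Im (u n)));
  apply is_lim_seq_mult'; try assumption; apply is_lim_seq_const.
- apply (is_lim_seq_plus' (fun n => Re c * Im (u n)) (fun n => Im c * Re (u n)));
  apply is_lim_seq_mult'; try assumption; apply is_lim_seq_const.
Qed.

Lemma is_Clim_ext (u v : nat -> C) (l : C) :
  (forall n, u n = v n) -> is_Clim u l -> is_Clim v l.
Proof.
intros He [H1 H2]; split; [apply is_lim_seq_ext with (2 := H1)|apply is_lim_seq_ext with (2 := H2)];
  intros n; now rewrite He.
Qed.

Lemma is_Clim_inj (u : nat -> C) (a b : C) : is_Clim u a -> is_Clim u b -> a = b.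
Proof.
intros [H1 H2] [H3 H4].
apply is_lim_seq_unique in H1, H2, H3, H4.
rewrite H1 in H3. rewrite H2 in H4. injection H3 as H3. injection H4 as H4.
now apply injective_projections.
Qed.

Lemma is_Clim_bound (u : nat -> C) (l : C) (B : R) :
  is_Clim u l -> (forall n, Cmod (u n) <= B) -> Cmod l <= B.
Proof.
intros [H1 H2] HB.
assert (B0 : 0 <= B) by (eapply Rle_trans; [apply Cmod_ge_0|apply (HB 0%nat)]).
assert (H : is_lim_seq (fun n => Re (u n) * Re (u n) + Im (u n) * Im (u n))
  (Re l * Re l + Im l * Im l))
  by (apply is_lim_seq_plus'; apply is_lim_seq_mult'; assumption).
assert (L : Rbar_le (Finite (Re l * Re l + Im l * Im l)) (Finite (B * B))).
{ apply (is_lim_seq_le _ (fun _ => B * B) _ _) with (2 := H); [|apply is_lim_seq_const].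
  intros n. specialize (HB n). assert (h := Cmod2_alt (u n)). assert (h0 := Cmod_ge_0 (u n)). nra. }
cbn [Rbar_le] in L.
assert (h := Cmod2_alt l). assert (h0 := Cmod_ge_0 l). nra.
Qed.

(** The limits that are read off from an explicit estimate below all have rate [1/n]. *)
Lemma is_Clim_small (u : nat -> C) (l : C) (K : R) :
  (forall n, (1 <= n)%nat -> Cmod (u n - l)%C <= K / INR n) -> is_Clim u l.
Proof.
intros H.
assert (Hz : is_lim_seq (fun n => K / INR n) 0).
{ replace (Finite 0) with (Rbar_mult K 0) by (cbn; f_equal; ring).
  apply is_lim_seq_scal_l.
  apply (is_lim_seq_inv INR p_infty); [apply is_lim_seq_INR|easy]. }
assert (G : forall (p : C -> R) , (forall a b, p (a - b)%C = p a - p b) ->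
  (forall a, Rabs (p a) <= Cmod a) ->
   is_lim_seq (fun n => p (u n)) (p l)).
{ intros p Hp Hb.
  apply is_lim_seq_ext with (fun n => p (u n) - p l + p l); [intros; ring|].
  replace (Finite (p l)) with (Finite (0 + p l)) by (f_equal; ring).
  apply is_lim_seq_plus'; [|apply is_lim_seq_const].
  apply is_lim_seq_abs_0.
  apply is_lim_seq_le_le_loc with (fun _ => 0) (fun n => K / INR n);
    [exists 1%nat|apply is_lim_seq_const|exact Hz].
  intros n Hn. split; [apply Rabs_pos|]. rewrite <- Hp.
  eapply Rle_trans; [apply Hb|now apply H]. }
split; apply G; try easy; [apply re_le_Cmod|apply Im_abs_le_Cmod].
Qed.

(** * Wallis integrals *)

Definition wallis (n : nat) : R := RInt (fun t => cos t ^ n) 0 (PI / 2).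

Lemma continuous_cos_pow (n : nat) (t : R) : continuous (fun t => cos t ^ n) t.
Proof.
apply (ex_derive_continuous (K := R_AbsRing) (V := R_NormedModule)).
auto_derive; easy.
Qed.

Lemma is_RInt_cos_pow (n : nat) (a b : R) :
  is_RInt (fun t => cos t ^ n) a b (RInt (fun t => cos t ^ n) a b).
Proof.
apply (RInt_correct (V := R_CompleteNormedModule)),
  (ex_RInt_continuous (V := R_CompleteNormedModule)).
intros; apply continuous_cos_pow.
Qed.

Lemma wallis_0 : wallis 0 = PI / 2.
Proof.
apply (is_RInt_inj (fun _ => 1) 0 (PI / 2)); [exact (is_RInt_cos_pow 0 0 (PI / 2))|].
replace (PI / 2) with (PI / 2 - 0) at 2 by ring.
apply (ftc (fun t => t)); [intros; exact (is_derive_id (K := R_AbsRing) x)|intros;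
  apply continuous_const].
Qed.

Lemma wallis_1 : wallis 1 = 1.
Proof.
apply (is_RInt_inj (fun t => cos t ^ 1) 0 (PI / 2)); [exact (is_RInt_cos_pow 1 0 (PI / 2))|].
replace 1 with (sin (PI / 2) - sin 0) by (rewrite sin_PI2, sin_0; ring).
apply (ftc sin); [intros x; auto_derive; [easy|ring]|apply continuous_cos_pow].
Qed.

Lemma wallis_rec (n : nat) : INR (n + 2) * wallis (S (S n)) = INR (n + 1) * wallis n.
Proof.
apply Rminus_diag_uniq.
apply (is_RInt_inj (fun t => INR (n + 2) * cos t ^ S (S n) - INR (n + 1) * cos t ^ n) 0 (PI / 2)).
- apply rint_minus; apply rint_scal, is_RInt_cos_pow.
- replace 0 with (sin (PI / 2) * cos (PI / 2) ^ S n - sin 0 * cos 0 ^ S n) at 2.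
  2: { rewrite cos_PI2, sin_0. cbn [pow]; ring. }
  apply (ftc (fun t => sin t * cos t ^ S n)).
  + intros t. auto_derive; [easy|]. cbn [Nat.pred].
    change (match n with 0%nat => 1 | S _ => INR n + 1 end) with (INR (S n)).
    replace (n + 2)%nat with (S (S n)) by lia. replace (n + 1)%nat with (S n) by lia.
    assert (H := sin2_cos2 t). unfold Rsqr in H.
    assert (E : sin t * sin t = 1 - cos t * cos t) by lra.
    rewrite (S_INR (S n)). cbn [pow].
    transitivity (cos t * (cos t * cos t ^ n) - INR (S n) * (sin t * sin t) * cos t ^ n); [ring|].
    rewrite E; ring.
  + intros t. apply (continuous_minus (V := R_NormedModule));
    apply (continuous_scal_r (V := R_NormedModule));
      apply continuous_cos_pow.
Qed.

Lemma cos_bounds (t : R) : 0 <= t <= PI / 2 -> 0 <= cos t <= 1.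
Proof.
intros Ht. split; [apply cos_ge_0; assert (H := PI_RGT_0); lra|apply COS_bound].
Qed.

Lemma wallis_decr (n : nat) : wallis (S n) <= wallis n.
Proof.
assert (Hpi := PI_RGT_0).
apply (is_RInt_le (fun t => cos t ^ S n) (fun t => cos t ^ n) 0 (PI / 2));
  try apply is_RInt_cos_pow; [lra|].
intros t Ht. assert (H := cos_bounds t ltac:(lra)). cbn [pow].
assert (0 <= cos t ^ n) by (apply pow_le; lra). nra.
Qed.

(** The recursion makes the left-hand side independent of [n]. *)
Lemma wallis_prod (n : nat) : INR (n + 1) * (wallis n * wallis (S n)) = PI / 2.
Proof.
induction n as [|n IH].
- rewrite wallis_0, wallis_1. cbn; ring.
- rewrite <- IH. assert (H := wallis_rec n).
  replace (S n + 1)%nat with (n + 2)%nat by lia.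
  replace (INR (n + 2) * (wallis (S n) * wallis (S (S n)))) with
    (wallis (S n) * (INR (n + 2) * wallis (S (S n)))) by ring.
  rewrite H. ring.
Qed.

Lemma wallis_pos (n : nat) : 0 < wallis n.
Proof.
assert (H := wallis_prod n). assert (Hpi := PI_RGT_0). assert (Hd := wallis_decr n).
assert (Hn : 0 < INR (n + 1)) by (apply lt_0_INR; lia).
assert (0 <= wallis (S n)).
{ apply (is_RInt_le (fun _ => 0) (fun t => cos t ^ S n) 0 (PI / 2)); [lra| | |].
  - replace 0 with (0 - 0) at 2 by ring.
    apply (ftc (fun _ => 0)); [intros; apply (der_const 0)|intros; apply continuous_const].
  - apply is_RInt_cos_pow.
  - intros t Ht. apply pow_le. apply cos_bounds; lra. }
destruct (Req_dec (wallis n) 0) as [e|e]; [rewrite e in H; lra|lra].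
Qed.

Lemma wallis_sq_bounds (n : nat) :
  INR n * wallis n ^ 2 <= PI / 2 <= INR (n + 1) * wallis n ^ 2.
Proof.
assert (Hp := wallis_pos n). split.
- destruct n as [|n].
  + cbn [INR]. assert (Hpi := PI_RGT_0); lra.
  + rewrite <- (wallis_prod n). replace (n + 1)%nat with (S n) by lia.
    apply Rmult_le_compat_l; [apply pos_INR|]. assert (H := wallis_decr n). nra.
- rewrite <- (wallis_prod n). apply Rmult_le_compat_l; [apply pos_INR|].
  assert (H := wallis_decr n). nra.
Qed.

Lemma wallis_even (m : nat) :
  wallis (2 * m) = PI / 2 * (INR (fact (2 * m)) / ((2 ^ m) ^ 2 * INR (fact m) ^ 2)).
Proof.
induction m as [|m IH].
- change (2 * 0)%nat with 0%nat. rewrite wallis_0. cbn; field.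
- assert (H := wallis_rec (2 * m)). rewrite IH in H.
  replace (2 * S m)%nat with (S (S (2 * m))) by lia.
  rewrite !fact_simpl, !mult_INR.
  replace (2 * m + 2)%nat with (2 * S m)%nat in H by lia.
  replace (2 * m + 1)%nat with (S (2 * m)) in H by lia.
  replace (S (S (2 * m))) with (2 * S m)%nat by lia.
  rewrite mult_INR in *. change (INR 2) with 2 in *.
  assert (Hm : INR (S m) <> 0) by now apply not_0_INR.
  assert (Hf := INR_fact_neq_0 m).
  assert (H2 : 2 ^ m <> 0) by (apply pow_nonzero; lra).
  apply (Rmult_eq_reg_l (2 * INR (S m))); [|nra].
  replace (S (S (2 * m))) with (2 * S m)%nat in H by lia.
  etransitivity; [exact H|]. cbn [pow]. field. auto.
Qed.

(** The substitution [t = x * tan s] turns the integral of [/ (x ^ 2 + t ^ 2) ^ S m]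
    from [0] to [t] into this one. *)
Definition cos_primitive (m : nat) (x t : R) : R :=
  / x ^ (2 * m + 1) * RInt (fun s => cos s ^ (2 * m)) 0 (atan (t / x)).

Lemma is_derive_cos_primitive (m : nat) (x t : R) :
  0 < x -> is_derive (cos_primitive m x) t (/ (x ^ 2 + t ^ 2) ^ S m).
Proof.
intros Hx.
assert (D : is_derive (fun y => RInt (fun s => cos s ^ (2 * m)) 0 y) (atan (t / x))
  (cos (atan (t / x)) ^ (2 * m))).
{ apply (is_derive_RInt (V := R_NormedModule) (fun s => cos s ^ (2 * m)) _ 0).
  - exists (mkposreal 1 Rlt_0_1). intros y _. apply is_RInt_cos_pow.
  - apply continuous_cos_pow. }
assert (D2 : is_derive (fun t => atan (t / x)) t (/ (1 + (t / x) ^ 2) * / x)).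
{ auto_derive; [easy|]. field. split; nra. }
eapply der_eq; [exact (der_scal _ _ _ _ (der_comp _ (fun t => atan (t / x)) t _ _ D D2))|].
rewrite (pow_mult _ 2 m).
assert (Hc : cos (atan (t / x)) ^ 2 = / (1 + (t / x) ^ 2)).
{ rewrite cos_atan. unfold Rsqr. unfold Rdiv at 1.
  rewrite Rmult_1_l, pow_inv, <- Rsqr_pow2, Rsqr_sqrt; [|nra].
  f_equal; ring. }
rewrite Hc, <- (pow_inv (x ^ 2 + t ^ 2)).
assert (E : / (x ^ 2 + t ^ 2) = / x ^ 2 * / (1 + (t / x) ^ 2)) by (field; split; nra).
rewrite E, Rpow_mult_distr, (pow_inv (x ^ 2)), pow_add, pow_mult, <- !tech_pow_Rmult.
field. repeat split; try lra; try (apply pow_nonzero); nra.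
Qed.

Lemma cos_primitive_0 (m : nat) (x : R) : cos_primitive m x 0 = 0.
Proof.
unfold cos_primitive. replace (0 / x) with 0 by (unfold Rdiv; ring).
rewrite atan_0. rewrite (RInt_point (V := R_CompleteNormedModule)). apply Rmult_0_r.
Qed.

Lemma cos_primitive_bound (m : nat) (x t : R) :
  0 < x -> 0 <= t -> cos_primitive m x t <= wallis (2 * m) / x ^ (2 * m + 1).
Proof.
intros Hx Ht. unfold cos_primitive, Rdiv at 2. rewrite (Rmult_comm (wallis _)).
apply Rmult_le_compat_l; [left; now apply Rinv_0_lt_compat, pow_lt|].
assert (Ha := atan_bound (t / x)).
assert (Ha0 : 0 <= atan (t / x)).
{ rewrite <- atan_0. destruct Ht as [Ht|<-].
  - left; apply atan_increasing. now apply Rdiv_lt_0_compat.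
  - right. f_equal. unfold Rdiv; ring. }
unfold wallis.
rewrite <- (RInt_Chasles (V := R_CompleteNormedModule) _ 0 (atan (t / x)) (PI / 2));
  try (eexists; apply is_RInt_cos_pow).
assert (0 <= RInt (fun s => cos s ^ (2 * m)) (atan (t / x)) (PI / 2)).
{ apply (RInt_ge_0 (fun s => cos s ^ (2 * m))); [lra|eexists; apply is_RInt_cos_pow|].
  intros s Hs. apply pow_le, cos_bounds; lra. }
match goal with |- ?a <= plus _ ?b => change (a <= a + b) end. lra.
Qed.

Lemma is_RInt_inv_pow_norm (m : nat) (x s : R) :
  0 < x -> is_RInt (fun u => / (x ^ 2 + (s + u) ^ 2) ^ S m) 0 1
    (cos_primitive m x (s + 1) - cos_primitive m x s).
Proof.
intros Hx.
assert (Hd : forall u, is_derive (fun u => cos_primitive m x (s + u)) u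
  (/ (x ^ 2 + (s + u) ^ 2) ^ S m)).
{ intros u. eapply der_eq; [|apply Rmult_1_l].
  apply (der_comp (cos_primitive m x) (fun u => s + u)); [now apply is_derive_cos_primitive|].
  auto_derive; easy. }
assert (Hc : forall u, continuous (fun u => / (x ^ 2 + (s + u) ^ 2) ^ S m) u).
{ intros u. apply (ex_derive_continuous (K := R_AbsRing) (V := R_NormedModule)).
  assert (Hp : forall v : R, 0 < (x ^ 2 + (s + v) ^ 2) ^ S m)
    by (intros v; apply pow_lt; assert (h := pow2_ge_0 (s + v));
      assert (h2 := pow2_gt_0 x ltac:(lra)); lra).
  specialize (Hp u). auto_derive. cbn [pow] in *. lra. }
assert (H := ftc _ _ 0 1 Hd Hc). cbv beta in H. now rewrite Rplus_0_r in H.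
Qed.

(** * Euler-Maclaurin summation in the right half-plane *)

Definition right_half (z : C) : Prop := 0 <= Re z /\ z <> 0.

Lemma right_half_shift (z : C) (t : R) : right_half z -> 0 <= t -> right_half (z + t)%C.
Proof.
intros [H1 H2] Ht. split; [change (0 <= Re z + t); lra|].
intros h. apply H2. injection h; intros h2 h1.
apply injective_projections; unfold Re in H1; cbn in *; lra.
Qed.

Lemma right_half_slit (z : C) : right_half z -> slit_plane z.
Proof.
intros [H1 H2] [H3 H4]. apply H2.
apply injective_projections; unfold Re, Im in *; cbn; lra.
Qed.

Lemma right_half_Cmod (z : C) : right_half z -> 0 < Cmod z.
Proof. intros [_ H]; now apply Cmod_gt_0. Qed.

(** The cross term [2 * t * Re z] is nonnegative and is dropped. *)
Lemma Cmod_shift (z : C) (t : R) :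
  right_half z -> 0 <= t -> Cmod z ^ 2 + t ^ 2 <= Cmod (z + t)%C ^ 2.
Proof. intros [H1 _] Ht. rewrite !Cmod2_alt. cbn [Re Im Cplus RtoC fst snd] in *.
  unfold Re, Im in *; cbn in *. nra. Qed.

Lemma Cmod_shift_ge (z : C) (t : R) : right_half z -> 0 <= t -> t <= Cmod (z + t)%C.
Proof.
intros Hz Ht. assert (H := Cmod_shift z t Hz Ht). assert (H0 := Cmod_ge_0 z).
assert (H1 := Cmod_ge_0 (z + t)%C). nra.
Qed.

(** The contribution of one unit interval to the Euler-Maclaurin remainder of order [n]
    for the logarithm, the interval being the one that starts at [w]. *)
Definition em_integrand (n : nat) (w : C) (u : R) : C := (RtoC (bpoly n u) * / (w + u) ^ n)%C.

Definition em_integral (n : nat) (w : C) : C :=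
  (RInt (fun u => Re (em_integrand n w u)) 0 1, RInt (fun u => Im (em_integrand n w u)) 0 1).

Lemma Cder_shift (w : C) (x : R) : Cder (fun u => w + RtoC u)%C x 1.
Proof.
eapply Cder_eq; [exact (Cder_plus (fun _ => w) (fun u => RtoC u) x _ _ (Cder_const w x)
   (Cder_RtoC (fun u => u) x 1 (is_derive_id (K := R_AbsRing) x)))|ring].
Qed.

Lemma Ccont_em_integrand (n : nat) (w : C) (x : R) :
  right_half w -> 0 <= x -> Ccont (em_integrand n w) x.
Proof.
intros Hw Hx. apply (Ccont_mult (fun u => RtoC (bpoly n u)) (fun u => / (w + u) ^ n)%C).
- apply Ccont_RtoC, continuous_bpoly.
- eapply Cder_Ccont, (Cder_inv_pow (fun u => w + RtoC u)%C); [|apply Cder_shift].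
  apply right_half_shift; easy.
Qed.

Lemma em_integral_correct (n : nat) (w : C) :
  right_half w -> is_cint (em_integrand n w) 0 1 (em_integral n w).
Proof.
intros Hw. apply is_cint_exists; [lra|]. intros x Hx; apply Ccont_em_integrand; [easy|lra].
Qed.

Lemma em_integral_parts (n : nat) (w : C) :
  right_half w -> (1 <= n)%nat ->
  em_integral n w =
    (RtoC (beta (S n)) * (/ (w + 1) ^ n - / w ^ n) + INR n * em_integral (S n) w)%C.
Proof.
intros Hw Hn.
assert (H1 := em_integral_correct n w Hw).
assert (H2 := is_cint_scal (INR n) _ _ _ _ (em_integral_correct (S n) w Hw)).
assert (H := is_cint_minus _ _ _ _ _ _ H1 H2).
set (F := fun u : R => (RtoC (bpoly (S n) u) * / (w + u) ^ n)%C).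
assert (HF : is_cint (fun u => em_integrand n w u - INR n * em_integrand (S n) w u)%C 0 1
  (F 1 - F 0)%C).
{ apply is_cint_ftc; [lra| |].
  - intros x Hx. assert (Hx0 : (w + x)%C <> 0) by (apply right_half_shift; [easy|lra]).
    eapply Cder_eq.
    + exact (Cder_mult (fun u => RtoC (bpoly (S n) u)) (fun u => / (w + u) ^ n)%C x _ _
        (Cder_RtoC _ _ _ (is_derive_bpoly n x))
        (Cder_inv_pow (fun u => w + RtoC u)%C n x 1 Hx0 (Cder_shift w x))).
    + unfold em_integrand. rewrite Cpow_S. field. split; [now apply Cpow_nz|easy].
  - intros x Hx. destruct (Ccont_em_integrand n w x Hw ltac:(lra)) as [c1 c2].
    destruct (Ccont_mult (fun _ => RtoC (INR n)) _ x (Ccont_RtoC _ x (continuous_const (INR n) x))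
      (Ccont_em_integrand (S n) w x Hw ltac:(lra))) as [c3 c4].
    split; [exact (continuous_minus (V := R_NormedModule) _ _ _ c1 c3)|exact
      (continuous_minus (V := R_NormedModule) _ _ _ c2 c4)]. }
assert (E := is_cint_inj _ _ _ _ _ H HF).
unfold F in E. destruct n as [|n]; [lia|].
rewrite bpoly_at_1, bpoly_at_0, Cplus_0_r in E.
transitivity ((em_integral (S n) w - INR (S n) * em_integral (S (S n)) w)
  + INR (S n) * em_integral (S (S n)) w)%C; [ring|].
rewrite E. ring.
Qed.

(** An explicit primitive: [bpoly 1 u / (w + u)] is [1 - (w + /2) / (w + u)]. *)
Lemma em_integral_1 (w : C) :
  right_half w -> em_integral 1 w = (1 - (w + / 2) * (Clog (w + 1) - Clog w))%C.
Proof.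
intros Hw. assert (H1 := em_integral_correct 1 w Hw).
set (F := fun u : R => (RtoC u - (w + / 2) * Clog (w + u))%C).
assert (HF : is_cint (em_integrand 1 w) 0 1 (F 1 - F 0)%C).
{ apply is_cint_ftc; [lra| |].
  - intros x Hx. assert (Hx0 := right_half_shift w x Hw (proj1 Hx)).
    eapply Cder_eq.
    + exact (Cder_minus (fun u => RtoC u) _ x _ _
      (Cder_RtoC (fun u => u) x 1 (is_derive_id (K := R_AbsRing) x))
        (Cder_scal (w + / 2)%C _ x _ (Cder_Clog (fun u => w + RtoC u)%C x 1
          (right_half_slit _ Hx0) (Cder_shift w x)))).
    + unfold em_integrand.
      replace (bpoly 1 x) with (x - / 2).
      2: { unfold bpoly, beta; rewrite sum_Sn, sum_O, bernoulli_0, bernoulli_1.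
        unfold plus; cbn; field. }
      rewrite Cpow_1_r, RtoC_minus, RtoC_inv by lra.
      destruct Hx0 as [_ Hx0]. field. easy.
  - intros x Hx; apply Ccont_em_integrand; [easy|lra]. }
rewrite (is_cint_inj _ _ _ _ _ H1 HF). unfold F. rewrite Cplus_0_r. ring.
Qed.

Fixpoint csum (f : nat -> C) (N : nat) : C :=
  match N with O => RtoC 0 | S N => (csum f N + f N)%C end.

Definition em_sum (n N : nat) (z : C) : C := csum (fun j => em_integral n (z + INR j)%C) N.

Lemma shift_S (z : C) (j : nat) : (z + INR j + 1)%C = (z + INR (S j))%C.
Proof. rewrite S_INR, RtoC_plus. ring. Qed.

Lemma em_sum_parts (n N : nat) (z : C) :
  right_half z -> (1 <= n)%nat ->
  em_sum n N z =
    (RtoC (beta (S n)) * (/ (z + INR N) ^ n - / z ^ n) + INR n * em_sum (S n) N z)%C.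
Proof.
intros Hz Hn. unfold em_sum. induction N as [|N IH]; cbn [csum].
- cbn [INR]. rewrite Cplus_0_r. ring.
- rewrite IH, em_integral_parts, shift_S; [ring| |easy].
  apply right_half_shift; [easy|apply pos_INR].
Qed.

(** Abel summation of [em_integral_1]. This links the sum of the logarithms in the Gauss
    product to Stirling's main terms. *)
Lemma em_sum_1 (N : nat) (z : C) :
  right_half z ->
  em_sum 1 N z = (INR N - (z + INR N + / 2) * Clog (z + INR N) + (z - / 2) * Clog z
                  + csum (fun j => Clog (z + INR j)%C) (S N))%C.
Proof.
intros Hz. unfold em_sum. induction N as [|N IH]; cbn [csum] in *.
- cbn [INR]. rewrite Cplus_0_r. field.
- rewrite IH, em_integral_1, shift_S by (apply right_half_shift; [easy|apply pos_INR]).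
  rewrite <- shift_S, S_INR, RtoC_plus. ring_simplify. field.
Qed.

Lemma em_sum_add (n N M : nat) (z : C) :
  em_sum n (N + M) z = (em_sum n N z + em_sum n M (z + INR N))%C.
Proof.
unfold em_sum. induction M as [|M IH]; cbn [csum].
- rewrite Nat.add_0_r. ring.
- rewrite Nat.add_succ_r. cbn [csum]. rewrite IH, plus_INR, RtoC_plus, Cplus_assoc. ring.
Qed.

(** On each interval the polynomial is at most its value at [0] and
    [|z + t| ^ 2 >= |z| ^ 2 + t ^ 2]; the remaining real integrals telescope to one over
    a half-line. *)
Lemma em_sum_bound (m N : nat) (z : C) :
  right_half z ->
  Cmod (em_sum (2 * S m) N z)
    <= Rabs (beta (2 * S m)) * (wallis (2 * m) / Cmod z ^ (2 * m + 1)).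
Proof.
intros Hz. assert (Hx := right_half_Cmod z Hz).
assert (Hj : Cmod (em_sum (2 * S m) N z) <= Rabs (beta (2 * S m)) * cos_primitive m (Cmod z)
  (INR N)).
{ unfold em_sum. induction N as [|N IH]; cbn [csum].
  - rewrite Cmod_0. cbn [INR]. rewrite cos_primitive_0. lra.
  - eapply Rle_trans; [apply Cmod_triangle|].
    assert (Hw := right_half_shift z (INR N) Hz (pos_INR N)).
    assert (HI : is_RInt (fun u => Rabs (beta (2 * S m)) *
      (/ (Cmod z ^ 2 + (INR N + u) ^ 2) ^ S m)) 0 1
      (Rabs (beta (2 * S m)) * (cos_primitive m (Cmod z) (INR (S N)) - cos_primitive m (Cmod z)
        (INR N)))).
    { apply rint_scal. rewrite S_INR. now apply is_RInt_inv_pow_norm. }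
    assert (HB := fun H => is_cint_bound _ _ 0 1 _ _ ltac:(lra) H
      (em_integral_correct (2 * S m) _ Hw) HI).
    assert (HJ : forall x, 0 <= x <= 1 -> Cmod (em_integrand (2 * S m) (z + INR N) x)
       <= Rabs (beta (2 * S m)) * / (Cmod z ^ 2 + (INR N + x) ^ 2) ^ S m).
    { intros x Hx1. unfold em_integrand. rewrite Cmod_mult, Cmod_R.
      assert (Hn0 := pos_INR N).
      replace (z + INR N + x)%C with (z + (INR N + x)%R)%C by (rewrite RtoC_plus; ring).
      assert (Hs := Cmod_shift z (INR N + x) Hz ltac:(lra)).
      assert (Hw2 := right_half_shift z (INR N + x) Hz ltac:(lra)).
      rewrite Cmod_inv, Cmod_pow, pow_mult by (apply Cpow_nz, Hw2).
      apply Rmult_le_compat; [apply Rabs_pos| |apply bpoly_even_bound; [lia|lra]|].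
      - left; apply Rinv_0_lt_compat, pow_lt, pow_lt. now apply right_half_Cmod.
      - apply Rinv_le_contravar; [apply pow_lt; nra|]. apply pow_incr. split; [nra|easy]. }
    specialize (HB HJ). lra. }
eapply Rle_trans; [exact Hj|]. apply Rmult_le_compat_l; [apply Rabs_pos|].
apply cos_primitive_bound; [easy|apply pos_INR].
Qed.

(** The integral of [bpoly n] of the fractional part of [u], divided by [(z + u) ^ n],
    over all [u >= 0]. For [n = 1] it converges only conditionally, hence the limit over
    whole intervals. *)
Definition em_limit (n : nat) (z : C) : C :=
  (real (Lim_seq (fun N => Re (em_sum n N z))), real (Lim_seq (fun N => Im (em_sum n N z)))).

Definition converges (u : nat -> C) : Prop := exists l, is_Clim u l.

Lemma em_limit_correct_aux (n : nat) (z : C) :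
  converges (fun N => em_sum n N z) -> is_Clim (fun N => em_sum n N z) (em_limit n z).
Proof.
intros [l [H1 H2]]. split; cbn [em_limit Re Im fst snd].
- now rewrite (is_lim_seq_unique _ _ H1).
- now rewrite (is_lim_seq_unique _ _ H2).
Qed.

(** The tail of the sum is the same sum started at [z + N], so the bound of
    [em_sum_bound] at that point makes the sequence Cauchy. *)
Lemma em_sum_2_converges (z : C) : right_half z -> converges (fun N => em_sum 2 N z).
Proof.
intros Hz.
set (K := Rabs (beta 2) * wallis 0).
assert (HK : 0 < K).
{ apply Rmult_lt_0_compat; [apply Rabs_pos_lt, (beta_even_neq_0 1); lia|apply wallis_pos]. }
assert (B : forall N M, (1 <= N)%nat -> Cmod (em_sum 2 (N + M) z - em_sum 2 N z)%C <= K / INR N).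
{ intros N M HN. rewrite em_sum_add.
  replace (em_sum 2 N z + em_sum 2 M (z + INR N) - em_sum 2 N z)%C with (em_sum 2 M (z + INR N))
    by ring.
  assert (HN0 : 0 < INR N) by (apply lt_0_INR; lia).
  assert (Hw := right_half_shift z (INR N) Hz ltac:(lra)).
  eapply Rle_trans; [apply (em_sum_bound 0 M _ Hw)|].
  change (2 * 1)%nat with 2%nat. change (2 * 0)%nat with 0%nat. cbn [Nat.add]. rewrite pow_1.
  unfold K, Rdiv. rewrite Rmult_assoc. apply Rmult_le_compat_l; [apply Rabs_pos|].
  apply Rmult_le_compat_l; [left; apply wallis_pos|].
  apply Rinv_le_contravar; [easy|]. apply Cmod_shift_ge; [easy|lra]. }
assert (G : forall (p : C -> R) , (forall a b, p (a - b)%C = p a - p b) ->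
  (forall a, Rabs (p a) <= Cmod a) ->
   ex_finite_lim_seq (fun n => p (em_sum 2 n z))).
{ intros p Hp Hb. apply ex_lim_seq_cauchy_corr. intros eps.
  destruct (INR_unbounded (2 * K / eps)) as [N HN].
  assert (He := cond_pos eps).
  assert (Hq : 0 < 2 * K / eps) by (apply Rdiv_lt_0_compat; lra).
  assert (HN1 : (1 <= N)%nat) by (apply INR_le; cbn; destruct N; [cbn in HN; lra|rewrite S_INR;
    assert (h := pos_INR N); lra]).
  exists N. intros n m Hn Hm.
  assert (HKN : K / INR N < eps / 2).
  { apply Rlt_div_l in HN; [|lra]. apply Rlt_div_l; [apply lt_0_INR; lia|]. lra. }
  assert (Bn := B N (n - N)%nat HN1). assert (Bm := B N (m - N)%nat HN1).
  replace (N + (n - N))%nat with n in Bn by lia. replace (N + (m - N))%nat with m in Bm by lia.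
  replace (p (em_sum 2 n z) - p (em_sum 2 m z)) with
    (p (em_sum 2 n z - em_sum 2 N z)%C - p (em_sum 2 m z - em_sum 2 N z)%C) by (rewrite !Hp; ring).
  assert (h1 := Hb (em_sum 2 n z - em_sum 2 N z)%C).
    assert (h2 := Hb (em_sum 2 m z - em_sum 2 N z)%C).
  eapply Rle_lt_trans; [apply Rabs_triang|]. rewrite Rabs_Ropp. lra. }
destruct (G Re) as [a Ha]; [easy|apply re_le_Cmod|].
destruct (G Im) as [b Hb]; [easy|apply Im_abs_le_Cmod|].
exists (a, b). split; assumption.
Qed.

Lemma inv_pow_shift_lim (n : nat) (z : C) :
  right_half z -> (1 <= n)%nat -> is_Clim (fun N => / (z + INR N) ^ n)%C 0.
Proof.
intros Hz Hn. apply is_Clim_small with 1. intros N HN.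
assert (HN1 : 1 <= INR N) by (apply (le_INR 1); easy).
assert (Hw := right_half_shift z (INR N) Hz ltac:(lra)).
replace (/ (z + INR N) ^ n - 0)%C with (/ (z + INR N) ^ n)%C by ring.
rewrite Cmod_inv, Cmod_pow by (apply Cpow_nz, Hw).
unfold Rdiv; rewrite Rmult_1_l. apply Rinv_le_contravar; [lra|].
assert (H := Cmod_shift_ge z (INR N) Hz ltac:(lra)).
destruct n as [|n]; [lia|]. cbn [pow].
assert (1 <= Cmod (z + INR N)%C ^ n) by (apply pow_R1_Rle; lra). nra.
Qed.

(** Integration by parts transfers convergence from order [2] to every other order. *)
Lemma em_limit_correct (n : nat) (z : C) :
  right_half z -> (1 <= n)%nat -> is_Clim (fun N => em_sum n N z) (em_limit n z).
Proof.
intros Hz Hn. apply em_limit_correct_aux.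
assert (Hb : forall n, (1 <= n)%nat -> is_Clim
   (fun N => RtoC (beta (S n)) * (/ (z + INR N) ^ n - / z ^ n))%C
     (RtoC (beta (S n)) * (0 - / z ^ n))%C).
{ intros m Hm. apply is_Clim_scal, is_Clim_minus;
  [now apply inv_pow_shift_lim|apply is_Clim_const]. }
destruct n as [|n]; [lia|]. clear Hn.
destruct n as [|n].
- destruct (em_sum_2_converges z Hz) as [l Hl]. eexists.
  eapply is_Clim_ext; [|exact (is_Clim_plus _ _ _ _ (Hb 1%nat (le_n 1))
    (is_Clim_scal (INR 1) _ _ Hl))].
  intros N; cbv beta. now rewrite (em_sum_parts 1).
- induction n as [|n [l Hl]]; [now apply em_sum_2_converges|]. eexists.
  eapply is_Clim_ext; [|exact (is_Clim_scal (/ INR (S (S n)))%C _ _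
    (is_Clim_minus _ _ _ _ Hl (Hb (S (S n)) ltac:(lia))))].
  intros N; cbv beta. rewrite (em_sum_parts (S (S n))) by (easy || lia). field.
  repeat split; try apply Cpow_nz; [apply Hz|apply right_half_shift; [easy|apply pos_INR]|].
  apply RtoC_neq, not_0_INR; lia.
Qed.

(** Iterated from [n = 1], this recursion produces Stirling's series term by term. *)
Lemma em_limit_rec (n : nat) (z : C) :
  right_half z -> (1 <= n)%nat ->
  em_limit n z = (- (RtoC (beta (S n)) / z ^ n) + INR n * em_limit (S n) z)%C.
Proof.
intros Hz Hn.
apply (is_Clim_inj (fun N => em_sum n N z)); [now apply em_limit_correct|].
eapply is_Clim_ext; [intros N; symmetry; now apply em_sum_parts|].
apply is_Clim_plus; [|apply is_Clim_scal, em_limit_correct; [easy|lia]].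
replace (- (RtoC (beta (S n)) / z ^ n))%C with (RtoC (beta (S n)) * (0 - / z ^ n))%C.
- apply is_Clim_scal, is_Clim_minus; [now apply inv_pow_shift_lim|apply is_Clim_const].
- unfold Cdiv. ring.
Qed.

Lemma em_limit_bound (m : nat) (z : C) :
  right_half z ->
  Cmod (em_limit (2 * S m) z) <= Rabs (beta (2 * S m)) * (wallis (2 * m) / Cmod z ^ (2 * m + 1)).
Proof.
intros Hz. apply (is_Clim_bound (fun N => em_sum (2 * S m) N z)).
- apply em_limit_correct; [easy|lia].
- intros N; now apply em_sum_bound.
Qed.

(** * The Gauss product as an exponential *)

Lemma Cexp_plus (a b : C) : Cexp (a + b)%C = (Cexp a * Cexp b)%C.
Proof.
unfold Cexp. change (Re (a + b)%C) with (Re a + Re b). change (Im (a + b)%C) with (Im a + Im b).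
rewrite exp_plus, cos_plus, sin_plus. unfold Cmult; cbn [fst snd]. f_equal; ring.
Qed.

Lemma Cexp_RtoC (x : R) : Cexp (RtoC x) = RtoC (exp x).
Proof.
unfold Cexp. change (Re (RtoC x)) with x. change (Im (RtoC x)) with 0.
rewrite cos_0, sin_0. unfold RtoC. f_equal; ring.
Qed.

Lemma Cexp_opp (a : C) : Cexp (- a)%C = (/ Cexp a)%C.
Proof.
assert (H : (Cexp (- a) * Cexp a = 1)%C).
{ rewrite <- Cexp_plus. replace (- a + a)%C with (RtoC 0) by ring. now rewrite Cexp_RtoC, exp_0. }
assert (Hn : Cexp a <> 0).
{ intros h. rewrite h, Cmult_0_r in H. injection H; lra. }
transitivity (Cexp (- a) * Cexp a / Cexp a)%C; [field; easy|]. rewrite H. field; easy.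
Qed.

(** The periodicity of the exponential, in the only form used later: the imaginary parts
    differ by a zero of [1 - cos]. *)
Lemma Cexp_inj_mod (a b : C) :
  Cexp a = Cexp b -> Re a = Re b /\ cos (Im a - Im b) = 1.
Proof.
intros H. unfold Cexp in H. injection H; intros Hs Hc.
set (p := Re a) in *. set (q := Re b) in *.
assert (Ha := exp_pos p). assert (Hb := exp_pos q).
assert (h1 := sin2_cos2 (Im a)). assert (h2 := sin2_cos2 (Im b)). unfold Rsqr in *.
assert (E : exp p = exp q).
{ apply Rsqr_inj; [lra|lra|]. unfold Rsqr.
  transitivity ((exp p * cos (Im a)) * (exp p * cos (Im a)) + (exp p * sin (Im a)) *
    (exp p * sin (Im a)));
    [replace (exp p * exp p) with (exp p * exp p * 1) by ring; rewrite <- h1; ring|].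
  rewrite Hs, Hc.
  transitivity (exp q * exp q * 1); [rewrite <- h2; ring|ring]. }
split; [now apply exp_inv|].
rewrite E in Hs, Hc. apply Rmult_eq_reg_l in Hs, Hc; try lra.
rewrite cos_minus, Hs, Hc. lra.
Qed.

Lemma rising_Cexp (z : C) (n : nat) :
  right_half z -> rising z n = Cexp (csum (fun j => Clog (z + INR j)%C) n).
Proof.
intros Hz. induction n as [|n IH]; cbn [rising csum].
- now rewrite Cexp_RtoC, exp_0.
- rewrite Cexp_plus, IH, Cexp_Clog; [easy|].
  apply right_half_slit, right_half_shift; [easy|apply pos_INR].
Qed.

Lemma Gamma_approx_Cexp (z : C) (n : nat) :
  right_half z ->
  Gamma_approx z n = Cexp (ln (INR (fact n)) + z * ln (INR n)
                           - csum (fun j => Clog (z + INR j)%C) (S n))%C.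
Proof.
intros Hz. unfold Gamma_approx, Cminus, Cdiv.
rewrite !Cexp_plus, Cexp_opp, Cexp_RtoC, exp_ln by apply INR_fact_lt_0.
now rewrite rising_Cexp.
Qed.

Lemma Clog_RtoC (x : R) : 0 < x -> Clog (RtoC x) = RtoC (ln x).
Proof.
intros Hx. unfold Clog. change (Im (RtoC x)) with 0. rewrite Cmod_R, Rabs_pos_eq by lra.
unfold Rdiv. rewrite Rmult_0_l, atan_0, Rmult_0_r. reflexivity.
Qed.

(** * The constant in Stirling's formula *)

(** The real sequence whose limit is the constant of Stirling's formula. *)
Definition stirling_defect (N : nat) : R := ln (INR (fact N)) + INR N - (INR N + / 2) * ln (INR N).

(** At [z = 1] the sum of logarithms is that of a factorial, so convergence of the
    defect is convergence of [em_sum 1]. *)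
Lemma stirling_defect_em_sum (N : nat) :
  stirling_defect (S N) = 1 + Re (em_sum 1 N 1).
Proof.
assert (H1 : right_half 1) by (split; [cbn; lra|apply RtoC_neq; lra]).
rewrite em_sum_1 by easy.
assert (E : forall n, csum (fun j => Clog (1 + INR j)%C) n = RtoC (ln (INR (fact n)))).
{ induction n as [|n IH]; cbn [csum].
  - cbn; now rewrite ln_1.
  - rewrite IH. replace (1 + INR n)%C with (RtoC (INR (S n))) by (rewrite S_INR, RtoC_plus; ring).
    rewrite Clog_RtoC by (apply lt_0_INR; lia).
    rewrite fact_simpl, mult_INR, ln_mult by first [apply INR_fact_lt_0|apply lt_0_INR; lia].
    rewrite RtoC_plus. ring. }
rewrite E.
replace (1 + INR N)%C with (RtoC (INR (S N))) by (rewrite S_INR, RtoC_plus; ring).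
rewrite !Clog_RtoC, ln_1 by first [lra|apply lt_0_INR; lia].
unfold stirling_defect. rewrite <- RtoC_inv by lra.
rewrite <- !RtoC_plus, <- RtoC_minus, <- !RtoC_mult, <- RtoC_minus, <- !RtoC_plus.
change (Re (RtoC ?x)) with x. unfold Re; cbn [RtoC fst]. rewrite S_INR. ring.
Qed.

(** Squeeze between the two bounds of [wallis_sq_bounds]. *)
Lemma wallis_limit : is_lim_seq (fun m => INR (2 * m) * wallis (2 * m) ^ 2) (PI / 2).
Proof.
assert (Hpi := PI_RGT_0).
apply is_lim_seq_le_le with (fun m => PI / 2 - PI / 2 * / (INR (2 * m + 1))) (fun _ => PI / 2).
- intros m. destruct (wallis_sq_bounds (2 * m)) as [L U]. split; [|easy].
  assert (Hm : 0 < INR (2 * m + 1)) by (apply lt_0_INR; lia).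
  apply (Rmult_le_reg_r (INR (2 * m + 1))); [easy|].
  rewrite Rmult_minus_distr_r, Rmult_assoc, Rinv_l, plus_INR in * by lra. cbn [INR] in *.
  assert (h := pos_INR (2 * m)). nra.
- replace (Finite (PI / 2)) with (Finite (PI / 2 - PI / 2 * 0)) by (f_equal; ring).
  apply is_lim_seq_minus'; [apply is_lim_seq_const|].
  apply is_lim_seq_mult'; [apply is_lim_seq_const|].
  apply (is_lim_seq_subseq (fun n => / INR n) 0 (fun m => (2 * m + 1)%nat)).
  + apply eventually_subseq. intros; lia.
  + apply (is_lim_seq_inv INR p_infty); [apply is_lim_seq_INR|easy].
- apply is_lim_seq_const.
Qed.

(** The combination in which the factorials form a central binomial coefficient, that
    is, an even Wallis integral. *)
Lemma stirling_defect_double (m : nat) :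
  (1 <= m)%nat ->
  stirling_defect (2 * m) - 2 * stirling_defect m
  = / 2 * ln (INR (2 * m) * wallis (2 * m) ^ 2) - ln PI.
Proof.
intros Hm. assert (Hpi := PI_RGT_0).
assert (Hm0 : 0 < INR m) by (apply lt_0_INR; lia).
assert (Hf := INR_fact_lt_0 m). assert (Hf2 := INR_fact_lt_0 (2 * m)).
assert (Hp : 0 < 2 ^ m) by (apply pow_lt; lra).
assert (Hw := wallis_pos (2 * m)).
assert (E : ln (wallis (2 * m)) = ln PI - ln 2 +
  (ln (INR (fact (2 * m))) - (2 * (INR m * ln 2) + 2 * ln (INR (fact m))))).
{ rewrite wallis_even. unfold Rdiv.
  rewrite !ln_mult, !ln_Rinv, !ln_mult, !ln_pow;
  try lra; try (apply Rinv_0_lt_compat); try apply Rmult_lt_0_compat; try apply pow_lt; try lra;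
  try (apply Rinv_0_lt_compat; lra).
  - cbn [INR]. ring.
  - apply Rinv_0_lt_compat, Rmult_lt_0_compat; now apply pow_lt. }
unfold stirling_defect. rewrite mult_INR, !ln_mult, ln_pow, E by (try apply pow_lt; cbn [INR]; lra).
cbn [INR]. replace (1 + 1) with 2 by ring. field.
Qed.

(** If [c] is the limit, the combination of [stirling_defect_double] tends to
    [c - 2 * c], while Wallis's limit evaluates it. *)
Lemma stirling_constant : is_lim_seq stirling_defect (/ 2 * ln (2 * PI)).
Proof.
assert (Hpi := PI_RGT_0).
assert (H1 : right_half 1) by (split; [cbn; lra|apply RtoC_neq; lra]).
assert (H0 : exists c : R, is_lim_seq stirling_defect c).
{ destruct (em_limit_correct 1 1 H1 (le_n 1)) as [H _].
  exists (1 + Re (em_limit 1 1)). apply is_lim_seq_incr_1.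
  apply is_lim_seq_ext with (fun N => 1 + Re (em_sum 1 N 1)); [intros; symmetry;
    apply stirling_defect_em_sum|].
  apply is_lim_seq_plus'; [apply is_lim_seq_const|exact H]. }
destruct H0 as [c Hc].
assert (Hc2 : is_lim_seq (fun m => stirling_defect (2 * m)) c).
{ apply (is_lim_seq_subseq stirling_defect c (fun m => (2 * m)%nat)); [|easy].
  apply eventually_subseq. intros; lia. }
assert (HA : is_lim_seq (fun m => stirling_defect (2 * m) - 2 * stirling_defect m) (c - 2 * c)).
{ apply is_lim_seq_minus'; [easy|]. apply is_lim_seq_mult'; [apply is_lim_seq_const|easy]. }
assert (HB : is_lim_seq (fun m => stirling_defect (2 * m) - 2 * stirling_defect m)
  (/ 2 * ln (PI / 2) - ln PI)).
{ apply is_lim_seq_ext_loc with (fun m => / 2 * ln (INR (2 * m) * wallis (2 * m) ^ 2) - ln PI).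
  - exists 1%nat; intros m Hm. symmetry; now apply stirling_defect_double.
  - apply is_lim_seq_minus'; [|apply is_lim_seq_const].
    apply is_lim_seq_mult'; [apply is_lim_seq_const|].
    apply (is_lim_seq_continuous ln); [|apply wallis_limit].
    apply derivable_continuous_pt. exists (/ (PI / 2)). apply derivable_pt_lim_ln; lra. }
apply is_lim_seq_unique in HA, HB. rewrite HA in HB. injection HB as HB.
replace (/ 2 * ln (2 * PI)) with c; [easy|].
unfold Rdiv in HB. rewrite ln_mult, ln_Rinv in HB by lra. rewrite ln_mult by lra. lra.
Qed.

(** * Stirling's formula for Gamma *)

(** [Clog (z + n) - ln n] is the integral of [z / (n + t * z)] over the unit interval,
    and the integrand differs from [z / n] by at most [|z| ^ 2 / n ^ 2]. *)
Lemma Clog_shift_expansion (z : C) (n : R) :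
  right_half z -> 1 <= n ->
  Cmod (Clog (z + n) - ln n - z / n)%C <= Cmod z ^ 2 / n ^ 2.
Proof.
intros Hz Hn.
assert (Hn0 : RtoC n <> 0) by (apply RtoC_neq; lra).
set (f := fun t : R => (RtoC n + RtoC t * z)%C).
assert (Df : forall t, Cder f t z).
{ intros t. eapply Cder_eq.
  - exact (Cder_plus (fun _ => RtoC n) (fun t => RtoC t * z)%C t _ _ (Cder_const n t)
      (Cder_mult (fun t => RtoC t) (fun _ => z) t _ _
        (Cder_RtoC (fun u => u) t 1 (is_derive_id (K := R_AbsRing) t)) (Cder_const z t))).
  - cbv beta; ring. }
assert (Hf : forall t, 0 <= t <= 1 -> n <= Re (f t)).
{ intros t Ht. destruct Hz as [Hz _]. change (Re (f t)) with (n + (t * Re z - 0 * Im z)). nra. }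
assert (Hf0 : forall t, 0 <= t <= 1 -> f t <> 0).
{ intros t Ht h. specialize (Hf t Ht). rewrite h in Hf. cbn in Hf. lra. }
set (G := fun t : R => (Clog (f t) - z / n * RtoC t)%C).
assert (H : is_cint (fun t => z * / f t - z / n)%C 0 1 (G 1 - G 0)%C).
{ apply is_cint_ftc; [lra| |].
  - intros t Ht. eapply Cder_eq.
    + refine (Cder_minus _ _ t _ _ (Cder_Clog f t z _ (Df t)) (Cder_scal (z / n)%C _ t _
        (Cder_RtoC (fun u => u) t 1 (is_derive_id (K := R_AbsRing) t)))).
      intros [h _]. specialize (Hf t Ht). lra.
    + unfold Cdiv. ring.
  - intros t Ht. eapply Cder_Ccont.
    exact (Cder_minus _ _ t _ _ (Cder_scal z _ t _ (Cder_inv f t z (Hf0 t Ht) (Df t)))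
      (Cder_const (z / n)%C t)). }
assert (E : (G 1 - G 0 = Clog (z + n) - ln n - z / n)%C).
{ unfold G, f. rewrite !Cmult_0_l, !Cmult_0_r, Cplus_0_r, Clog_RtoC by lra.
  rewrite Cmult_1_l, Cmult_1_r, (Cplus_comm n z). ring. }
rewrite <- E.
apply (is_cint_bound _ (fun _ => Cmod z ^ 2 / n ^ 2) 0 1 _ _ ltac:(lra)) with (2 := H).
- intros t Ht.
  replace (z * / f t - z / n)%C with (- (RtoC t * (z * z)) / (f t * n))%C.
  2: { unfold f. field. split; [easy|exact (Hf0 t Ht)]. }
  rewrite Cmod_div by (apply Cmult_neq_0; [now apply Hf0|easy]).
  rewrite Cmod_opp, !Cmod_mult, !Cmod_R, !Rabs_pos_eq by lra.
  specialize (Hf t Ht). assert (Hc := re_le_Cmod (f t)). rewrite Rabs_pos_eq in Hc by lra.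
  unfold Rdiv. apply Rmult_le_compat.
  + repeat apply Rmult_le_pos; try apply Cmod_ge_0; lra.
  + left. apply Rinv_0_lt_compat. nra.
  + assert (h := Cmod_ge_0 z). nra.
  + apply Rinv_le_contravar; nra.
- evar_last; [apply (is_RInt_const (V := R_NormedModule))|].
  unfold scal; cbn -[pow]; unfold mult; cbn -[pow]. as_R. ring.
Qed.

Lemma shifted_log_limit (z : C) :
  right_half z ->
  is_Clim (fun N => (z + INR N + / 2) * (Clog (z + INR N) - ln (INR N)))%C z.
Proof.
intros Hz. set (x := Cmod z). assert (Hx : 0 <= x) by apply Cmod_ge_0.
apply is_Clim_small with ((x + 3 / 2) * x ^ 2 + (x + / 2) * x). intros N HN.
set (n := INR N). assert (Hn : 1 <= n) by (apply (le_INR 1); easy).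
assert (Hn0 : RtoC n <> 0) by (apply RtoC_neq; lra).
assert (He := Clog_shift_expansion z n Hz Hn). fold x in He.
set (e := (Clog (z + n) - ln n - z / n)%C) in *.
replace ((z + n + / 2) * (Clog (z + n) - ln n) - z)%C with
  ((z + n + / 2) * e + (z + / 2) * (z / n))%C.
2: { unfold e. field. easy. }
assert (H2 : Cmod (/ 2)%C = / 2).
{ rewrite <- RtoC_inv by lra. rewrite Cmod_R, Rabs_pos_eq; lra. }
assert (B1 : Cmod (z + n + / 2)%C <= x + n + / 2).
{ eapply Rle_trans; [apply Cmod_triangle|]. rewrite H2. apply Rplus_le_compat_r.
  eapply Rle_trans; [apply Cmod_triangle|]. rewrite Cmod_R, Rabs_pos_eq; unfold x; lra. }
assert (B2 : Cmod (z + / 2)%C <= x + / 2).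
{ eapply Rle_trans; [apply Cmod_triangle|]. rewrite H2. unfold x; lra. }
eapply Rle_trans; [apply Cmod_triangle|]. rewrite !Cmod_mult, Cmod_div by easy.
rewrite (Cmod_R n), (Rabs_pos_eq n) by lra. fold x.
unfold Rdiv at 2. rewrite Rmult_plus_distr_r. apply Rplus_le_compat.
- apply Rle_trans with ((x + n + / 2) * (x ^ 2 / n ^ 2)).
  + apply Rmult_le_compat; try apply Cmod_ge_0; easy.
  + replace ((x + n + / 2) * (x ^ 2 / n ^ 2)) with ((x + n + / 2) / n * x ^ 2 * / n) by (field;
    lra).
    apply Rmult_le_compat_r; [left; apply Rinv_0_lt_compat; lra|].
    apply Rmult_le_compat_r; [nra|]. apply Rle_div_l; [lra|]. nra.
- unfold Rdiv. rewrite Rmult_assoc. apply Rmult_le_compat; try apply Cmod_ge_0; try easy.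
  apply Rmult_le_pos; [easy|]. left; apply Rinv_0_lt_compat; lra.
Qed.

(** Stirling's formula with its exact error term. *)
Definition stirling_lnGamma (z : C) : C :=
  ((z - / 2) * Clog z - z + RtoC (/ 2 * ln (2 * PI)) - em_limit 1 z)%C.

Lemma log_Gamma_approx_limit (z : C) :
  right_half z ->
  is_Clim (fun n => ln (INR (fact n)) + z * ln (INR n)
                    - csum (fun j => Clog (z + INR j)%C) (S n))%C (stirling_lnGamma z).
Proof.
intros Hz.
apply is_Clim_ext with (fun N => (z - / 2) * Clog z - (z + INR N + / 2) *
  (Clog (z + INR N) - ln (INR N))
  + RtoC (stirling_defect N) - em_sum 1 N z)%C.
{ intros N. rewrite (em_sum_1 N z Hz). unfold stirling_defect.
  rewrite !RtoC_minus, !RtoC_plus, RtoC_mult, RtoC_plus, RtoC_inv by lra. ring. }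
apply is_Clim_minus; [|apply em_limit_correct; [easy|lia]].
apply is_Clim_plus.
- apply is_Clim_minus; [apply is_Clim_const|now apply shifted_log_limit].
- split; [exact stirling_constant|apply is_lim_seq_const].
Qed.

Lemma Gamma_eq_Cexp (z : C) : right_half z -> Gamma z = Cexp (stirling_lnGamma z).
Proof.
intros Hz. destruct (log_Gamma_approx_limit z Hz) as [H1 H2].
set (u := fun n => (ln (INR (fact n)) + z * ln (INR n) - csum (fun j => Clog (z + INR j)%C)
  (S n))%C) in *.
assert (He : is_lim_seq (fun n => exp (Re (u n))) (exp (Re (stirling_lnGamma z)))).
{ apply (is_lim_seq_continuous exp); [|exact H1]. apply derivable_continuous, derivable_exp. }
assert (Hc : is_lim_seq (fun n => cos (Im (u n))) (cos (Im (stirling_lnGamma z)))).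
{ apply (is_lim_seq_continuous cos); [|exact H2]. apply continuity_cos. }
assert (Hs : is_lim_seq (fun n => sin (Im (u n))) (sin (Im (stirling_lnGamma z)))).
{ apply (is_lim_seq_continuous sin); [|exact H2]. apply continuity_sin. }
unfold Gamma, Cexp.
rewrite (Lim_seq_ext (fun n => Re (Gamma_approx z n)) (fun n => exp (Re (u n)) * cos (Im (u n)))).
2: { intros n; now rewrite Gamma_approx_Cexp. }
rewrite (Lim_seq_ext (fun n => Im (Gamma_approx z n)) (fun n => exp (Re (u n)) * sin (Im (u n)))).
2: { intros n; now rewrite Gamma_approx_Cexp. }
rewrite (is_lim_seq_unique _ _ (is_lim_seq_mult' _ _ _ _ He Hc)).
rewrite (is_lim_seq_unique _ _ (is_lim_seq_mult' _ _ _ _ He Hs)). reflexivity.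
Qed.

(** * The branch of the logarithm *)

(** One step of [em_limit_rec] and the bound in order [2] give
    [(1 + PI / 2) / (12 * |z|)]. *)
Lemma em_limit_1_bound (z : C) : right_half z -> Cmod (em_limit 1 z) <= / (4 * Cmod z).
Proof.
intros Hz. assert (Hx := right_half_Cmod z Hz).
rewrite em_limit_rec by (easy || lia). cbn [INR]. rewrite Cpow_1_r, Cmult_1_l.
assert (Hb := em_limit_bound 0 z Hz). change (2 * 1)%nat with 2%nat in Hb.
change (2 * 0)%nat with 0%nat in Hb. cbn [Nat.add] in Hb. rewrite pow_1, wallis_0 in Hb.
assert (B2 : beta 2 = / 12) by (unfold beta; rewrite bernoulli_2; cbn; field).
rewrite B2, Rabs_pos_eq in Hb by lra.
eapply Rle_trans; [apply Cmod_triangle|].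
rewrite Cmod_opp, Cmod_div, B2, Cmod_R, Rabs_pos_eq by (lra || apply Hz).
assert (P := PI_4). assert (Hi := Rinv_0_lt_compat _ Hx).
replace (/ (4 * Cmod z)) with (/ 4 * / Cmod z) by (field; lra). unfold Rdiv in *. nra.
Qed.

(** [D] takes values in the multiples of [2 * PI] and stays within [1/2] of a continuous
    function that starts at [0]. To reach another multiple, the continuous function
    would have to pass through [PI] or [- PI], where the cosine of [D] is negative. *)
Lemma winding_zero (A D : R -> R) :
  (forall t, 0 <= t <= 1 -> continuity_pt A t) -> A 0 = 0 ->
  (forall t, 0 <= t <= 1 -> Rabs (D t - A t) <= / 2) ->
  (forall t, 0 <= t <= 1 -> cos (D t) = 1) -> D 1 = 0.
Proof.
intros Hc H0 HDA Hcos. assert (P2 := PI2_1).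
assert (Hno : forall t s, 0 <= t <= 1 -> Rabs s = 1 -> s * A t <> PI).
{ intros t s Ht Hs h. specialize (HDA t Ht). specialize (Hcos t Ht).
  apply Rabs_le_between in HDA.
  assert (hs : s = 1 \/ s = -1) by (revert Hs; unfold Rabs; destruct (Rcase_abs s); lra).
  assert (cos (D t) < 0).
  { destruct hs as [-> | ->].
    - apply cos_lt_0; lra.
    - rewrite <- cos_neg. apply cos_lt_0; lra. }
  lra. }
assert (Hle : forall s, Rabs s = 1 -> s * A 1 <= PI).
{ intros s Hs. apply Rnot_lt_le; intros hlt.
  destruct (Ranalysis5.IVT_interv (fun t => s * A t - PI) 0 1) as [t [Ht Et]].
  - intros t Ht. apply continuity_pt_minus; [|apply continuity_pt_const; easy].
    apply continuity_pt_scal. now apply Hc.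
  - lra.
  - rewrite H0. lra.
  - lra.
  - apply (Hno t s Ht Hs). lra. }
assert (L1 := Hle 1 Rabs_R1). assert (L2 := Hle (-1) ltac:(rewrite Rabs_left; lra)).
assert (HD := HDA 1 ltac:(lra)). apply Rabs_le_between in HD.
assert (Hc1 := Hcos 1 ltac:(lra)).
set (d := D 1) in *.
assert (Hsin : sin (d / 2) = 0).
{ replace d with (2 * (d / 2)) in Hc1 by field. rewrite cos_2a_sin in Hc1. nra. }
destruct (Rtotal_order d 0) as [h|[h|h]]; [|easy|].
- assert (0 < sin (- (d / 2))) by (apply sin_gt_0; lra). rewrite sin_neg in *. lra.
- assert (0 < sin (d / 2)) by (apply sin_gt_0; lra). lra.
Qed.

(** Both sides are logarithms of [Gamma]. Along the segment from [|z|] to [z] their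
    difference is, up to the error [em_limit 1], a continuous function; on the segment
    the modulus is at least [1/2], which keeps that error below [1/2], and on the real
    axis the imaginary parts vanish. *)
Lemma lnGamma_eq (L : C -> C) (z : C) :
  is_lnGamma L -> right_half z -> 1 <= Cmod z -> L z = stirling_lnGamma z.
Proof.
intros (Hder & Hexp & Hreal) Hz Hx.
set (x := Cmod z) in *.
set (g := fun t : R => (RtoC x + RtoC t * (z - RtoC x))%C).
assert (Dg : forall t, Cder g t (z - RtoC x)).
{ intros t. eapply Cder_eq.
  - exact (Cder_plus (fun _ => RtoC x) (fun t => RtoC t * (z - RtoC x))%C t _ _ (Cder_const x t)
      (Cder_mult (fun t => RtoC t) (fun _ => (z - RtoC x)%C) t _ _
        (Cder_RtoC (fun u => u) t 1 (is_derive_id (K := R_AbsRing) t))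
          (Cder_const (z - RtoC x)%C t))).
  - cbv beta; ring. }
assert (Rg : forall t, Re (g t) = (1 - t) * x + t * Re z).
{ intros t. unfold g, Re; cbn; ring. }
assert (Ig : forall t, Im (g t) = t * Im z).
{ intros t. unfold g, Im; cbn; ring. }
assert (Hnorm : forall t, 0 <= t <= 1 -> / 2 <= Cmod (g t)).
{ intros t Ht. assert (h := Cmod2_alt (g t)). assert (h0 := Cmod_ge_0 (g t)).
  assert (hz := Cmod2_alt z). fold x in hz. rewrite Rg, Ig in h. destruct Hz as [Hz _].
  assert (0 <= 2 * (t * (1 - t)) * (x * Re z)) by (apply Rmult_le_pos; nra).
  assert (E : Cmod (g t) ^ 2 = ((1 - t) ^ 2 + t ^ 2) * x ^ 2 + 2 * (t * (1 - t)) * (x * Re z)).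
  { rewrite h.
    transitivity ((1 - t) ^ 2 * x ^ 2 + t ^ 2 * (Re z ^ 2 + Im z ^ 2) + 2 * (t * (1 - t)) *
      (x * Re z));
      [ring|rewrite <- hz; ring]. }
  clear h. clearbody x. assert (hs := pow2_ge_0 (t - / 2)).
  assert (h2 : / 2 <= (1 - t) ^ 2 + t ^ 2) by lra.
  assert (h3 : 1 <= x ^ 2) by nra.
  assert (h4 : / 2 <= Cmod (g t) ^ 2) by nra. nra. }
assert (Hg : forall t, 0 <= t <= 1 -> right_half (g t)).
{ intros t Ht. split.
  - rewrite Rg. destruct Hz as [Hz _]. assert (h := Cmod_ge_0 z). fold x in h. nra.
  - intros h. specialize (Hnorm t Ht). rewrite h, Cmod_0 in Hnorm. lra. }
assert (g1 : g 1 = z) by (unfold g; ring).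
set (F := fun t => ((g t - / 2) * Clog (g t) - g t)%C).
assert (DF : forall t, 0 <= t <= 1 -> ex_derive (fun t => Im (F t)) t).
{ intros t Ht.
  destruct (Cder_minus _ _ t _ _ (Cder_mult _ _ t _ _
    (Cder_minus _ _ t _ _ (Dg t) (Cder_const (/ 2)%C t))
    (Cder_Clog g t _ (right_half_slit _ (Hg t Ht)) (Dg t))) (Dg t)) as [_ h].
  eexists; exact h. }
assert (Hex : forall t, 0 <= t <= 1 -> Re (L (g t)) = Re (stirling_lnGamma (g t)) /\
    cos (Im (L (g t)) - Im (stirling_lnGamma (g t))) = 1).
{ intros t Ht. apply Cexp_inj_mod. rewrite Hexp by now apply right_half_slit, Hg.
  now apply Gamma_eq_Cexp, Hg. }
assert (HD : Im (L (g 1)) - Im (stirling_lnGamma (g 1)) = 0).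
{ apply (winding_zero (fun t => Im (L (g t)) - Im (F t))
  (fun t => Im (L (g t)) - Im (stirling_lnGamma (g t)))).
  - intros t Ht. apply continuity_pt_minus.
    2: { apply continuity_pt_filterlim.
         apply (ex_derive_continuous (K := R_AbsRing) (V := R_NormedModule)). now apply DF. }
    assert (Hc := ex_derive_continuous (K := C_AbsRing) (V := C_NormedModule) L (g t)
      (Hder _ (right_half_slit _ (Hg t Ht)))).
    intros eps Heps.
    destruct (Hc (fun y => ball (L (g t)) eps y)) as [d Hd].
    { exists (mkposreal eps Heps). intros y Hy; exact Hy. }
    set (K := Cmod (z - RtoC x)%C + 1).
      assert (HK : 0 < K) by (unfold K; assert (h := Cmod_ge_0 (z - RtoC x)%C); lra).
    exists (d / K). split; [apply Rdiv_lt_0_compat; [apply cond_pos|easy]|].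
    intros s [_ Hs]. change (Rabs (s - t) < d / K) in Hs.
    change (Rabs (Im (L (g s)) - Im (L (g t))) < eps).
    assert (Hb : ball (L (g t)) eps (L (g s))).
    { apply Hd. change (Cmod (minus (g s) (g t)) < d).
      replace (minus (g s) (g t)) with (RtoC (s - t) * (z - RtoC x))%C.
      2: { rewrite RtoC_minus. unfold g.
           match goal with |- _ = minus ?a ?b => change (minus a b) with (a - b)%C end. ring. }
      rewrite Cmod_mult, Cmod_R. apply Rlt_div_r in Hs; [|easy].
      assert (h := Rabs_pos (s - t)). assert (h' := Cmod_ge_0 (z - RtoC x)%C). unfold K in Hs.
        nra. }
    exact (proj2 Hb).
  - assert (g0 : g 0 = RtoC x) by (unfold g; ring).
    unfold F. rewrite g0, Clog_RtoC by lra.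
    rewrite (proj1 (Hreal x ltac:(lra))).
    rewrite <- RtoC_inv, <- RtoC_minus, <- RtoC_mult, <- RtoC_minus by lra.
    unfold Im; cbn; ring.
  - intros t Ht.
    replace (Im (L (g t)) - Im (stirling_lnGamma (g t)) - (Im (L (g t)) - Im (F t))) with
      (Im (em_limit 1 (g t))).
    2: { unfold stirling_lnGamma. fold (F t). unfold Im; cbn. ring. }
    eapply Rle_trans; [apply Im_abs_le_Cmod|]. eapply Rle_trans; [now apply em_limit_1_bound, Hg|].
    specialize (Hnorm t Ht). apply Rinv_le_contravar; lra.
  - intros t Ht. now apply Hex. }
destruct (Hex 1 ltac:(lra)) as [HR _]. rewrite g1 in *.
apply injective_projections; [exact HR|]. change (Im (L z) = Im (stirling_lnGamma z)). lra.
Qed.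

(** * Numerical solution of the recursion *)

Lemma PI_approx : (3141 / 1000) < PI < (31417 / 10000).
Proof.
destruct (PI_2_3_7_ineq 2) as [L U].
unfold tg_alt, PI_2_3_7_tg, Ratan_seq in L, U. cbn in L, U. lra.
Qed.

Lemma inv_PI_sq_approx : (1013 / 10000) <= / PI ^ 2 <= (1014 / 10000).
Proof.
assert (H := PI_approx). assert ((9865 / 1000) < PI ^ 2 < (98704 / 10000)) by nra.
split.
- rewrite <- (Rinv_inv (1013 / 10000)). apply Rinv_le_contravar; lra.
- rewrite <- (Rinv_inv (1014 / 10000)). apply Rinv_le_contravar; lra.
Qed.

(** The bound of [remainder_ratio_cap] for the quotient of a remainder by the last term
    before it; it does not depend on [z] and grows like the square root of [PI * m]. *)
Definition em_factor (m : nat) : R := INR (2 * m + 1) * wallis (2 * m).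

Lemma em_factor_0 : em_factor 0 = PI / 2.
Proof. unfold em_factor. change (2 * 0)%nat with 0%nat. rewrite wallis_0. cbn; ring. Qed.

Lemma em_factor_S (m : nat) : em_factor (S m) = em_factor m * (INR (2 * m + 3) / INR (2 * m + 2)).
Proof.
unfold em_factor. assert (H := wallis_rec (2 * m)).
assert (Hn : INR (2 * m + 2) <> 0) by (apply not_0_INR; lia).
replace (2 * S m)%nat with (S (S (2 * m))) by lia.
replace (S (S (2 * m)) + 1)%nat with (2 * m + 3)%nat by lia.
apply (Rmult_eq_reg_l (INR (2 * m + 2))); [|easy].
transitivity (INR (2 * m + 3) * (INR (2 * m + 2) * wallis (S (S (2 * m))))); [ring|].
rewrite H. field. easy.
Qed.

Lemma em_factor_pos (m : nat) : 0 < em_factor m.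
Proof. apply Rmult_lt_0_compat; [apply lt_0_INR; lia|apply wallis_pos]. Qed.

Lemma em_factor_linear (m : nat) : em_factor m <= (1571 / 1000) * INR (S m).
Proof.
assert (P := PI_approx).
induction m as [|m IH]; [rewrite em_factor_0; cbn; lra|].
rewrite em_factor_S. assert (Hp := em_factor_pos m).
replace (INR (2 * m + 3)) with (2 * INR m + 3) by (rewrite plus_INR, mult_INR; cbn; ring).
replace (INR (2 * m + 2)) with (2 * INR m + 2) by (rewrite plus_INR, mult_INR; cbn; ring).
rewrite !S_INR in *. assert (Hm := pos_INR m). set (x := INR m) in *.
apply Rle_trans with (em_factor m * ((x + 2) / (x + 1))).
- apply Rmult_le_compat_l; [lra|]. apply Rle_div_l; [lra|].
  replace ((x + 2) / (x + 1) * (2 * x + 2)) with (2 * (x + 2)) by (field; lra). lra.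
- replace (em_factor m * ((x + 2) / (x + 1))) with (em_factor m * / (x + 1) * (x + 2)) by (field;
  lra).
  replace ((1571 / 1000) * (x + 1 + 1)) with ((1571 / 1000) * (x + 2)) by ring.
  apply Rmult_le_compat_r; [lra|]. apply Rmult_le_reg_r with (x + 1); [lra|].
  rewrite Rmult_assoc, Rinv_l by lra. lra.
Qed.

(** The recursion of [remainder_chain] with the factor rounded up, run for [d] steps
    from the starting value [Y]. Evaluating it on literals settles the small values of
    [k]. *)
Fixpoint unrolled (k Y : R) (d : nat) (x : R) : R :=
  match d with
  | O => Y
  | S d => x * (x - / 2) / k ^ 2 * (1014 / 10000) * (1 + unrolled k Y d (x + 1))
  end.

(** What is known about the quotients [a n] of the remainder after the [n]-th term by
    that term, with [|z|] replaced by its smallest value [k] and [q = / PI ^ 2]: an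
    inequality that runs downwards in [n], and a crude bound from which to start it. *)
Definition remainder_chain (q : R) (k : nat) (a : nat -> R) : Prop :=
  (forall n, (k <= n)%nat ->
     a n <= INR n * (INR n - / 2) / INR k ^ 2 * q * (1 + a (S n))) /\
  (forall m, a (S m) <= em_factor m).

Lemma unrolled_step (q : R) (k : nat) (a : nat -> R) (n : nat) (Y : R) :
  (1013 / 10000) <= q <= (1014 / 10000) -> (1 <= k)%nat -> remainder_chain q k a ->
  (k <= n)%nat -> 0 <= Y -> a (S n) <= Y ->
  a n <= INR n * (INR n - / 2) / INR k ^ 2 * (1014 / 10000) * (1 + Y).
Proof.
intros Hq Hk [Hstep Hcap]. assert (Hk0 : 0 < INR k) by (apply lt_0_INR; lia).
intros Hn HY Ha. eapply Rle_trans; [now apply Hstep|].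
assert (Hn1 : 1 <= INR n) by (apply (le_INR 1); lia).
assert (0 <= INR n * (INR n - / 2) / INR k ^ 2).
{ apply Rmult_le_pos; [nra|]. left; apply Rinv_0_lt_compat. now apply pow_lt. }
rewrite !(Rmult_assoc (_ / _)). apply Rmult_le_compat_l; [easy|]. nra.
Qed.

Lemma unrolled_correct (q : R) (k : nat) (a : nat -> R) (Y : R) (d n : nat) :
  (1013 / 10000) <= q <= (1014 / 10000) -> (1 <= k)%nat -> remainder_chain q k a ->
  (k <= n)%nat -> 0 <= Y -> a (n + d)%nat <= Y ->
  0 <= unrolled (INR k) Y d (INR n) /\ a n <= unrolled (INR k) Y d (INR n).
Proof.
intros Hq Hk Hch. assert (Hk0 : 0 < INR k) by (apply lt_0_INR; lia).
intros Hn HY. revert n Hn. induction d as [|d IH]; intros n Hn Ha; cbn [unrolled].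
- rewrite Nat.add_0_r in Ha. lra.
- destruct (IH (S n)) as [H1 H2]; [lia|now replace (S n + d)%nat with (n + S d)%nat by lia|].
  rewrite S_INR in H1, H2. split; [|now apply (unrolled_step q)].
  assert (Hn1 : 1 <= INR n) by (apply (le_INR 1); lia).
  assert (0 <= INR n * (INR n - / 2) / INR k ^ 2).
  { apply Rmult_le_pos; [nra|]. left; apply Rinv_0_lt_compat. now apply pow_lt. }
  apply Rmult_le_pos; [apply Rmult_le_pos; [easy|lra]|lra].
Qed.

(** This pays for the crude starting value in [large_k_bound]; [7] is the least exponent
    for which it holds, whence the threshold [14] on [k]. *)
Lemma pow3_dominates (i : nat) : 9 * (2 * INR (7 + i) + 1) ^ 2 <= 3 ^ (7 + i).
Proof.
induction i as [|i IH].
- change (INR (7 + 0)) with (INR 7). rewrite INR_IZR_INZ.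
  cbn [Z.of_nat Pos.of_succ_nat Pos.succ]. cbn [Nat.add]. lra.
- replace (7 + S i)%nat with (S (7 + i)) by lia. rewrite S_INR. cbn [pow] in *.
  assert (h : 7 <= INR (7 + i)) by (rewrite plus_INR; assert (h := pos_INR i); cbn [INR] in *; lra).
  set (y := INR (7 + i)) in *. nra.
Qed.

(** Downward induction from [n = k + k/2] with the bound
    [c i = al + 0.27 / k * (3 ^ i - 1)] for [a (k + i)], where [al = q / (1 - q)] is the
    fixed point of [a = q * (1 + a)]. Up to [i = k/2] the factor of the recursion stays
    below [0.2282 < 1/3], so a term growing like [3 ^ i] absorbs the error; it is large
    enough at [i = k/2] to dominate the linear starting value and small enough at
    [i = 1] to leave [0.54 / k]. *)
Lemma large_k_bound (q : R) (k : nat) (a : nat -> R) :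
  (1013 / 10000) <= q <= (1014 / 10000) -> (1 <= k)%nat -> remainder_chain q k a ->
  (14 <= k)%nat -> a (S k) <= q / (1 - q) + (54 / 100) / INR k.
Proof.
intros Hq Hk [Hstep Hcap]. assert (Hk0 : 0 < INR k) by (apply lt_0_INR; lia).
intros Hk14. set (al := q / (1 - q)). set (x := INR k) in *.
assert (Hx : 14 <= x) by (unfold x; replace 14 with (INR 14) by (rewrite INR_IZR_INZ;
  reflexivity); now apply le_INR).
assert (Hal : q * (1 + al) = al) by (unfold al; field; lra).
assert (Hal2 : (1127 / 10000) <= al <= (1129 / 10000)).
{ split; nra. }
set (I := Nat.div2 k).
assert (HI : (2 * I <= k <= 2 * I + 1)%nat).
{ unfold I. assert (h := Nat.div2_odd k). destruct (Nat.odd k); cbn [Nat.b2n] in h; lia. }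
assert (HI7 : (7 <= I)%nat) by lia.
assert (HIx : INR I <= x / 2).
{ unfold x. assert (h := le_INR _ _ (proj1 HI)). rewrite mult_INR in h. cbn [INR] in h. lra. }
set (c := fun i => al + (27 / 100) / x * (3 ^ i - 1)).
assert (Hdown : forall j, (j < I)%nat -> a (k + (I - j))%nat <= c (I - j)%nat).
{ induction j as [|j IH]; intros Hj.
  - rewrite Nat.sub_0_r. replace (k + I)%nat with (S (k + I - 1)) by lia.
    eapply Rle_trans; [apply Hcap|]. eapply Rle_trans; [apply em_factor_linear|].
    replace (S (k + I - 1)) with (k + I)%nat by lia.
    rewrite plus_INR. fold x.
    assert (hp := pow3_dominates (I - 7)). replace (7 + (I - 7))%nat with I in hp by lia.
    assert (hx : x <= 2 * INR I + 1).
    { unfold x. assert (h := le_INR _ _ (proj2 HI)). rewrite plus_INR, mult_INR in h.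
      cbn [INR] in h. lra. }
    assert (hp2 : 9 * x ^ 2 <= 3 ^ I) by nra.
    unfold c. apply Rle_trans with ((27 / 100) / x * (9 * x ^ 2 - 1)).
    + replace ((27 / 100) / x * (9 * x ^ 2 - 1)) with ((243 / 100) * x - (27 / 100) * / x) by
      (field; lra).
      assert (/ x <= 1) by (rewrite <- Rinv_1; apply Rinv_le_contravar; lra). lra.
    + assert ((27 / 100) / x * (9 * x ^ 2 - 1) <= (27 / 100) / x * (3 ^ I - 1)); [|lra].
      apply Rmult_le_compat_l; [|lra]. apply Rmult_le_pos; [lra|].
        left; apply Rinv_0_lt_compat; lra.
  - specialize (IH ltac:(lia)).
    set (i := (I - S j)%nat) in *. replace (I - j)%nat with (S i) in IH by (unfold i; lia).
    replace (k + S i)%nat with (S (k + i)) in IH by lia.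
    eapply Rle_trans; [apply Hstep; lia|].
    rewrite plus_INR. fold x.
    assert (Hi : (1 <= i <= I)%nat) by (unfold i; lia).
    set (s := INR i / x).
    assert (Hs : 0 <= s <= / 2).
    { unfold s. split; [apply Rmult_le_pos; [apply pos_INR|left; apply Rinv_0_lt_compat; lra]|].
      apply Rle_div_l; [lra|]. assert (h := le_INR _ _ (proj2 Hi)). lra. }
    assert (Hi0 : INR i = s * x) by (unfold s; field; lra).
    assert (Hi1 : 1 <= INR i) by (apply (le_INR 1); lia).
    set (p := (1 + s) ^ 2).
    assert (Hp : 1 <= p <= (225 / 100)) by (unfold p; nra).
    assert (Hc0 : 0 <= c (S i)).
    { unfold c. assert (1 <= 3 ^ S i) by (apply pow_R1_Rle; lra).
      assert (0 <= (27 / 100) / x * (3 ^ S i - 1)); [|lra].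
      apply Rmult_le_pos; [apply Rmult_le_pos; [lra|left; apply Rinv_0_lt_compat; lra]|lra]. }
    apply Rle_trans with (q * p * (1 + c (S i))).
    { assert (E : (x + INR i) * (x + INR i - / 2) / x ^ 2 <= p).
      { apply Rle_div_l; [nra|]. unfold p. rewrite Hi0. nra. }
      assert (0 <= (x + INR i) * (x + INR i - / 2) / x ^ 2).
      { apply Rmult_le_pos; [nra|]. left; apply Rinv_0_lt_compat; nra. }
      set (w := (x + INR i) * (x + INR i - / 2) / x ^ 2) in *.
      apply Rle_trans with (w * q * (1 + c (S i))).
      - apply Rmult_le_compat_l; [apply Rmult_le_pos|]; lra.
      - rewrite (Rmult_comm q p). apply Rmult_le_compat_r; [lra|].
        apply Rmult_le_compat_r; lra. }
    unfold c. cbn [pow]. set (t := 3 ^ i).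
    (* The claim multiplied by k, with the identity q (1 + al) = al used to cancel
       the constant parts; only the growth of (1 + s)^2 is left to pay for. *)
    assert (Key : al * (INR i * (2 + s)) <= (27 / 100) * (t * (1 - 3 * (q * p)) - 1 + q * p)).
    { assert (Hqp : (1013 / 10000) <= q * p <= (1014 / 10000) * p) by nra.
      assert (Hcase : i = 1%nat \/ i = 2%nat \/ (3 <= i)%nat) by lia.
      destruct Hcase as [e|[e|e]].
      - assert (Hs1 : s <= / 14).
        { unfold s; rewrite e. cbn [INR]. unfold Rdiv; rewrite Rmult_1_l.
          apply Rinv_le_contravar; lra. }
        assert (p <= (1149 / 1000)) by (unfold p; nra).
        unfold t. rewrite e. cbn [INR pow]. nra.
      - assert (Hs1 : s <= / 7).
        { unfold s; rewrite e. cbn [INR]. apply Rle_div_l; lra. }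
        assert (p <= (1307 / 1000)) by (unfold p; nra).
        unfold t. rewrite e. cbn [INR pow]. nra.
      - assert (Ht : 9 * INR i <= t).
        { unfold t. clear - e. induction e as [|m e IH]; [cbn; lra|].
          rewrite S_INR. cbn [pow]. assert (1 <= INR m) by (apply (le_INR 1); lia). lra. }
        assert (Hqp2 : q * p <= (22815 / 100000)) by lra.
        assert ((31555 / 100000) * t <= t * (1 - 3 * (q * p))) by nra.
        assert (al * (INR i * (2 + s)) <= (1129 / 10000) * (INR i * (25 / 10))) by
          (apply Rmult_le_compat; nra).
        lra. }
    apply Rmult_le_reg_r with x; [lra|].
    replace ((al + (27 / 100) / x * (t - 1)) * x) with (al * x + (27 / 100) * (t - 1)) by (field;
      lra).
    replace (q * p * (1 + (al + (27 / 100) / x * (3 * t - 1))) * x) with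
      (p * (q * (1 + al)) * x + (27 / 100) * (q * p) * (3 * t - 1)) by (field; lra).
    rewrite Hal.
    assert (Ep : p * x = x + INR i * (2 + s)) by (unfold p; rewrite Hi0; ring).
    replace (p * al * x) with (al * (p * x)) by ring. rewrite Ep. nra. }
specialize (Hdown (I - 1)%nat ltac:(lia)). replace (I - (I - 1))%nat with 1%nat in Hdown by lia.
replace (k + 1)%nat with (S k) in Hdown by lia. unfold c in Hdown. rewrite pow_1 in Hdown.
unfold Rdiv in *. lra.
Qed.

(** The factor [1 - / (2 * k)] of the last step leaves a margin of about [0.556 / k]
    above [q / (1 - q)] for [a (S k)], and [large_k_bound] uses [0.54 / k] of it. Below
    [14] five values of the recursion, or fewer, suffice; for [k = 1, 2] the linear
    bound on the starting value is too weak and the exact Wallis product is used. *)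
Lemma first_step_bound (q : R) (k : nat) (a : nat -> R) :
  (1013 / 10000) <= q <= (1014 / 10000) -> (1 <= k)%nat -> remainder_chain q k a ->
  (1 - / (2 * INR k)) * (1 + a (S k)) < / (1 - q).
Proof.
intros Hq Hk Hch. assert (Hk0 : 0 < INR k) by (apply lt_0_INR; lia).
assert (Hi : (11127 / 10000) <= / (1 - q)).
{ rewrite <- (Rinv_inv (11127 / 10000)). apply Rinv_le_contravar; lra. }
destruct (le_lt_dec 14 k) as [h|h].
- assert (H := large_k_bound q k a Hq Hk Hch h). assert (Hx := Hk0). set (x := INR k) in *.
  assert (hx : 1 <= x) by (apply (le_INR 1); lia).
  apply Rle_lt_trans with ((1 - / (2 * x)) * (1 + (q / (1 - q) + (54 / 100) / x))).
  + apply Rmult_le_compat_l; [|lra].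
    assert (/ (2 * x) <= / 2) by (apply Rinv_le_contravar; lra). lra.
  + replace (1 + (q / (1 - q) + (54 / 100) / x)) with (/ (1 - q) + (54 / 100) / x) by (field; lra).
    set (g := / (1 - q)) in *.
    replace (/ (2 * x)) with (/ 2 * / x) by (field; lra). unfold Rdiv.
    assert (0 < / x) by now apply Rinv_0_lt_compat. nra.
- assert (P := PI_approx).
  (* [em_factor m] bounds [a (S m)]. The recursion is started at [n = 3] for [k = 1], at
     [n = 6] for [k = 2], and with the linear bound at [n = k + 5] for the other [k]. *)
  assert (C3 : em_factor 2 <= (29455 / 10000)).
  { rewrite !em_factor_S, em_factor_0. cbn [INR Nat.mul Nat.add]. lra. }
  assert (C6 : em_factor 5 <= (426 / 100)).
  { rewrite !em_factor_S, em_factor_0. cbn [INR Nat.mul Nat.add]. lra. }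
  assert (Fin : forall Y d, 0 <= Y -> a (S k + d)%nat <= Y ->
     (1 - / (2 * INR k)) * (1 + unrolled (INR k) Y d (INR (S k))) < 11127 / 10000 ->
     (1 - / (2 * INR k)) * (1 + a (S k)) < / (1 - q)).
  { intros Y d HY Ha Hlt. destruct (unrolled_correct q k a Y d (S k) Hq Hk Hch) as [_ H];
    [lia|easy|easy|].
    eapply Rle_lt_trans; [|eapply Rlt_le_trans; [exact Hlt|exact Hi]].
    apply Rmult_le_compat_l; [|lra].
    assert (h1 := le_INR 1 k Hk). cbn [INR] in h1.
    assert (/ (2 * INR k) <= / 2) by (apply Rinv_le_contravar; lra). lra. }
  assert (Lin : a (S k + 4)%nat <= (1571 / 1000) * INR (S k + 4)).
  { eapply Rle_trans; [apply Hch|apply em_factor_linear]. }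
  assert (Hcases : (k = 1 \/ k = 2 \/ 3 <= k)%nat) by lia.
  destruct Hcases as [e|[e|e]].
  + apply (Fin (29455 / 10000) 1%nat); [lra| |].
    * rewrite e. eapply Rle_trans; [apply (proj2 Hch 2%nat)|lra].
    * rewrite e. rewrite !INR_IZR_INZ. cbn [Z.of_nat Pos.of_succ_nat Pos.succ unrolled]. lra.
  + apply (Fin (426 / 100) 3%nat); [lra| |].
    * rewrite e. eapply Rle_trans; [apply (proj2 Hch 5%nat)|lra].
    * rewrite e. rewrite !INR_IZR_INZ. cbn [Z.of_nat Pos.of_succ_nat Pos.succ unrolled]. lra.
  + apply (Fin ((1571 / 1000) * INR (S k + 4)) 4%nat); [|exact Lin|].
    * apply Rmult_le_pos; [lra|apply pos_INR].
    * clear - e h.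
      do 14 (destruct k as [|k]; [try (exfalso; lia);
        rewrite !INR_IZR_INZ; cbn [Z.of_nat Pos.of_succ_nat Pos.succ unrolled Nat.add]; lra|]).
      exfalso; lia.
Qed.

(** * Stirling terms and remainders *)

Lemma stirling_term_eq (m : nat) (z : C) :
  z <> 0 ->
  stirling_term (S m) z = (RtoC (beta (2 * S m) * INR (fact (2 * m))) / z ^ (2 * m + 1))%C.
Proof.
intros Hz. unfold stirling_term, beta.
replace (2 * S m - 1)%nat with (2 * m + 1)%nat by lia.
replace (fact (2 * S m)) with ((2 * S m) * (2 * m + 1) * fact (2 * m))%nat.
2: { replace (2 * S m)%nat with (S (S (2 * m))) at 2 by lia. rewrite 2!fact_simpl. lia. }
set (n := (2 * S m * (2 * m + 1))%nat).
assert (Hn : INR n <> 0) by (apply not_0_INR; unfold n; lia).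
assert (Hf := INR_fact_neq_0 (2 * m)).
rewrite mult_INR.
replace (bernoulli (2 * S m) / (INR n * INR (fact (2 * m))) * INR (fact (2 * m))) with
  (bernoulli (2 * S m) * / INR n)
  by (field; easy).
rewrite RtoC_mult, RtoC_inv by easy. field.
split; [now apply (RtoC_neq _ 0)|now apply Cpow_nz].
Qed.

Lemma Cmod_stirling_term (m : nat) (z : C) :
  z <> 0 ->
  Cmod (stirling_term (S m) z)
  = Rabs (beta (2 * S m)) * INR (fact (2 * m)) / Cmod z ^ (2 * m + 1).
Proof.
intros Hz. rewrite stirling_term_eq, Cmod_div, Cmod_pow, Cmod_R, Rabs_mult by (try apply Cpow_nz;
  easy).
rewrite (Rabs_pos_eq (INR _)) by apply pos_INR. easy.
Qed.

Lemma Cmod_stirling_term_pos (m : nat) (z : C) : z <> 0 -> 0 < Cmod (stirling_term (S m) z).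
Proof.
intros Hz. rewrite Cmod_stirling_term by easy.
apply Rdiv_lt_0_compat; [|now apply pow_lt, Cmod_gt_0].
apply Rmult_lt_0_compat; [|apply INR_fact_lt_0].
apply Rabs_pos_lt, beta_even_neq_0; lia.
Qed.

Lemma stirling_term_ratio (m : nat) (z : C) :
  z <> 0 ->
  Cmod (stirling_term (S (S m)) z)
  <= INR (S m) * (INR (S m) - / 2) / Cmod z ^ 2 * / PI ^ 2 * Cmod (stirling_term (S m) z).
Proof.
intros Hz. rewrite !Cmod_stirling_term by easy.
assert (Hx := proj1 (Cmod_gt_0 z) Hz). set (x := Cmod z) in *.
assert (Hpi := PI_RGT_0).
assert (Hr := beta_even_ratio (S m) ltac:(lia)).
set (b := Rabs (beta (2 * S m))) in *. set (b' := Rabs (beta (2 * S (S m)))) in *.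
replace (2 * S m + 1)%nat with (2 * m + 1 + 2)%nat by lia. rewrite pow_add.
replace (INR (fact (2 * S m))) with (4 * (INR (S m) * (INR (S m) - / 2)) * INR (fact (2 * m))).
2: { replace (2 * S m)%nat with (S (S (2 * m))) by lia.
  rewrite !fact_simpl, !mult_INR, !S_INR, mult_INR.
     cbn [INR]. field. }
assert (Hm : 1 <= INR (S m)) by (apply (le_INR 1); lia).
assert (Hf := INR_fact_lt_0 (2 * m)).
assert (Hp : 0 < x ^ (2 * m + 1)) by now apply pow_lt.
set (N := INR (S m)) in *. set (F := INR (fact (2 * m))) in *. set (y := x ^ (2 * m + 1)) in *.
replace (b' * (4 * (N * (N - / 2)) * F) / (y * x ^ 2)) with
  (b' * (4 * PI ^ 2) * (N * (N - / 2) / x ^ 2 * / PI ^ 2 * (F / y))) by (field; lra).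
replace (N * (N - / 2) / x ^ 2 * / PI ^ 2 * (b * F / y)) with
  (b * (N * (N - / 2) / x ^ 2 * / PI ^ 2 * (F / y))) by (field; lra).
apply Rmult_le_compat_r; [|easy].
repeat apply Rmult_le_pos; try lra; left; apply Rinv_0_lt_compat; try apply pow_lt; lra.
Qed.

Lemma stirling_remainder_S (L : C -> C) (m : nat) (z : C) :
  stirling_remainder L (S (S m)) z = (stirling_remainder L (S m) z - stirling_term (S m) z)%C.
Proof.
unfold stirling_remainder. replace (S (S m) - 1)%nat with (S m) by lia.
replace (S m - 1)%nat with m by lia.
rewrite sum_n_Sm by lia.
match goal with |- context [plus ?a ?b] => change (plus a b) with (a + b)%C end. ring.
Qed.

(** Two steps of [em_limit_rec] at a time: the first yields the term [T_(m+1)], the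
    second nothing, since the odd Bernoulli number vanishes. *)
Lemma stirling_remainder_eq (L : C -> C) (m : nat) (z : C) :
  is_lnGamma L -> right_half z -> 1 <= Cmod z ->
  stirling_remainder L (S m) z = (- (INR (fact (2 * m)) * em_limit (2 * m + 1) z))%C.
Proof.
intros HL Hz Hx. induction m as [|m IH].
- unfold stirling_remainder. rewrite (lnGamma_eq L z HL Hz Hx). unfold stirling_lnGamma.
  rewrite sum_n_m_zero by lia. change (@zero C_AbelianMonoid) with (RtoC 0).
  change (INR (fact (2 * 0))) with 1. change (2 * 0 + 1)%nat with 1%nat.
  rewrite RtoC_mult, RtoC_inv by lra. ring.
- rewrite stirling_remainder_S, IH, stirling_term_eq by apply Hz.
  rewrite (em_limit_rec (2 * m + 1)), (em_limit_rec (S (2 * m + 1))) by (easy || lia).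
  replace (S (S (2 * m + 1))) with (2 * S m + 1)%nat by lia.
  rewrite beta_odd by lia. replace (S (2 * m + 1)) with (2 * S m)%nat by lia.
  replace (INR (fact (2 * S m))) with (INR (2 * m + 1) * (INR (2 * S m) * INR (fact (2 * m)))).
  2: { replace (fact (2 * S m)) with ((2 * m + 1) * (2 * S m * fact (2 * m)))%nat;
    [now rewrite !mult_INR|].
       replace (2 * S m)%nat with (S (S (2 * m))) at 2 by lia. rewrite 2!fact_simpl. lia. }
  rewrite !RtoC_mult. field. split; apply Cpow_nz, Hz.
Qed.

Definition remainder_ratio (L : C -> C) (z : C) (n : nat) : R :=
  Cmod (stirling_remainder L (S n) z) / Cmod (stirling_term n z).

(** One step of [em_limit_rec] from [stirling_remainder_eq] reaches an even order, where
    [em_limit_bound] applies. *)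
Lemma remainder_ratio_cap (L : C -> C) (m : nat) (z : C) :
  is_lnGamma L -> right_half z -> 1 <= Cmod z ->
  remainder_ratio L z (S m) <= em_factor m.
Proof.
intros HL Hz Hx. unfold remainder_ratio.
assert (Hp := Cmod_stirling_term_pos m z (proj2 Hz)).
apply Rle_div_l; [easy|].
rewrite stirling_remainder_S, stirling_remainder_eq by easy.
rewrite (em_limit_rec (2 * m + 1)) by (easy || lia).
replace (S (2 * m + 1)) with (2 * S m)%nat by lia.
replace (- (INR (fact (2 * m)) * (- (beta (2 * S m) / z ^ (2 * m + 1)) + INR (2 * m + 1) *
  em_limit (2 * S m) z))
   - stirling_term (S m) z)%C with (- (INR (fact (2 * m)) * INR (2 * m + 1) * em_limit (2 * S m)
     z))%C.
2: { rewrite stirling_term_eq, RtoC_mult by apply Hz. field. apply Cpow_nz, Hz. }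
rewrite Cmod_opp, !Cmod_mult, !Cmod_R, !Rabs_pos_eq by apply pos_INR.
rewrite Cmod_stirling_term by apply Hz. unfold em_factor.
assert (H := em_limit_bound m z Hz).
replace (INR (2 * m + 1) * wallis (2 * m) *
  (Rabs (beta (2 * S m)) * INR (fact (2 * m)) / Cmod z ^ (2 * m + 1)))
  with (INR (fact (2 * m)) * INR (2 * m + 1) *
    (Rabs (beta (2 * S m)) * (wallis (2 * m) / Cmod z ^ (2 * m + 1))))
  by (unfold Rdiv; ring).
apply Rmult_le_compat_l; [apply Rmult_le_pos; apply pos_INR|easy].
Qed.

Lemma remainder_ratio_step (L : C -> C) (m : nat) (z : C) :
  z <> 0 ->
  remainder_ratio L z (S m)
  <= INR (S m) * (INR (S m) - / 2) / Cmod z ^ 2 * / PI ^ 2 * (1 + remainder_ratio L z (S (S m))).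
Proof.
intros Hz. unfold remainder_ratio.
assert (Hp := Cmod_stirling_term_pos m z Hz). assert (Hp' := Cmod_stirling_term_pos (S m) z Hz).
apply Rle_div_l; [easy|].
assert (E : stirling_remainder L (S (S m)) z =
  (stirling_remainder L (S (S (S m))) z + stirling_term (S (S m)) z)%C)
  by (rewrite (stirling_remainder_S L (S m)); ring).
rewrite E. eapply Rle_trans; [apply Cmod_triangle|].
assert (Hr := stirling_term_ratio m z Hz).
set (t := Cmod (stirling_term (S m) z)) in *. set (t' := Cmod (stirling_term (S (S m)) z)) in *.
set (r := Cmod (stirling_remainder L (S (S (S m))) z)).
assert (0 <= r) by apply Cmod_ge_0.
set (c := _ * / PI ^ 2) in *.
replace (r + t') with (t' * (1 + r / t')) by (field; lra).
replace (c * (1 + r / t') * t) with (c * t * (1 + r / t')) by ring.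
apply Rmult_le_compat_r; [|easy].
assert (0 <= r / t') by (apply Rmult_le_pos; [easy|left; now apply Rinv_0_lt_compat]). lra.
Qed.

(** Only the first step of the recursion uses the true modulus of [z] and so supplies
    the factor [(k / |z|) ^ 2]; all later steps use [k <= |z|]. *)
Lemma remainder_ratio_bound (L : C -> C) (k : nat) (z : C) :
  is_lnGamma L -> (1 <= k)%nat -> right_half z -> INR k <= Cmod z ->
  remainder_ratio L z k < (INR k / Cmod z) ^ 2 / (PI ^ 2 - 1).
Proof.
intros HL Hk Hz Hkz.
assert (Hk1 : 1 <= INR k) by (apply (le_INR 1); lia).
assert (Hq := inv_PI_sq_approx). assert (HP := PI_approx).
set (q := / PI ^ 2) in *. set (x := Cmod z) in *.
assert (Hpos : forall n, (1 <= n)%nat -> 0 <= remainder_ratio L z n).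
{ intros [|n] Hn; [lia|]. apply Rmult_le_pos; [apply Cmod_ge_0|].
  left; apply Rinv_0_lt_compat, Cmod_stirling_term_pos, Hz. }
assert (Hchain : remainder_chain q k (remainder_ratio L z)).
{ split.
  - intros [|n] Hn; [lia|].
    eapply Rle_trans; [apply remainder_ratio_step, Hz|]. fold x q.
    specialize (Hpos (S (S n)) ltac:(lia)).
    apply Rmult_le_compat_r; [lra|]. apply Rmult_le_compat_r; [lra|].
    assert (1 <= INR (S n)) by (apply (le_INR 1); lia).
    apply Rmult_le_compat_l; [nra|]. apply Rinv_le_contravar; [nra|]. apply pow_incr; lra.
  - intros m. apply remainder_ratio_cap; [easy|easy|]. fold x; lra. }
assert (Hf := first_step_bound q k _ Hq Hk Hchain).
destruct k as [|m]; [lia|].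
eapply Rle_lt_trans; [apply remainder_ratio_step, Hz|]. fold x q.
set (N := INR (S m)) in *. set (r := remainder_ratio L z (S (S m))) in *.
replace (N * (N - / 2) / x ^ 2 * q * (1 + r)) with
  ((N / x) ^ 2 * q * ((1 - / (2 * N)) * (1 + r))) by (field; lra).
replace ((N / x) ^ 2 / (PI ^ 2 - 1)) with ((N / x) ^ 2 * q * / (1 - q)).
2: { unfold q. field. repeat split; nra. }
apply Rmult_lt_compat_l; [|easy].
apply Rmult_lt_0_compat; [|lra]. apply pow_lt, Rdiv_lt_0_compat; lra.
Qed.

Theorem theorem2 (lnGamma : C -> C) (HlnGamma : is_lnGamma lnGamma)
    (k : nat) (z : C) (Hk : (1 <= k)%nat) (Hre : 0 <= Re z)
    (Hz : z <> RtoC 0) (Hkz : INR k <= Cmod z) :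
  (Cmod (stirling_remainder lnGamma (S k) z / stirling_term k z)%C
     < (INR k / Cmod z) ^ 2 / (PI ^ 2 - 1)
   /\ (INR k / Cmod z) ^ 2 / (PI ^ 2 - 1) <= 1 / (PI ^ 2 - 1)
   /\ 1 / (PI ^ 2 - 1) < 0.113)
  /\
  (Cmod (stirling_remainder lnGamma k z / stirling_term k z)%C
     < 1 + (INR k / Cmod z) ^ 2 / (PI ^ 2 - 1)
   /\ 1 + (INR k / Cmod z) ^ 2 / (PI ^ 2 - 1) <= PI ^ 2 / (PI ^ 2 - 1)
   /\ PI ^ 2 / (PI ^ 2 - 1) < 1.113).
Proof.
assert (Hb := remainder_ratio_bound lnGamma k z HlnGamma Hk (conj Hre Hz) Hkz).
assert (HP := PI_approx). assert (HP2 : 9865 / 1000 < PI ^ 2) by nra.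
assert (Hk1 : 1 <= INR k) by (apply (le_INR 1); lia).
set (g := / (PI ^ 2 - 1)).
assert (Hg : 0 < g) by (apply Rinv_0_lt_compat; lra).
assert (Hg2 : g < 0.113).
{ unfold g. rewrite <- (Rinv_inv 0.113). apply Rinv_lt_contravar; lra. }
assert (Hd : PI ^ 2 / (PI ^ 2 - 1) = 1 + g) by (unfold g; field; lra).
assert (Hr : (INR k / Cmod z) ^ 2 <= 1).
{ rewrite <- (pow1 2). apply pow_incr. split.
  - apply Rmult_le_pos; [lra|]. left; apply Rinv_0_lt_compat; lra.
  - apply Rle_div_l; lra. }
assert (Ht : stirling_term k z <> 0).
{ destruct k as [|m]; [lia|]. apply Cmod_gt_0. now apply Cmod_stirling_term_pos. }
rewrite Hd. unfold remainder_ratio, Rdiv in *. fold g in Hb |- *.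
rewrite <- Cmod_inv, <- Cmod_mult in Hb by easy.
assert (Hgr : (INR k * / Cmod z) ^ 2 * g <= 1 * g) by (apply Rmult_le_compat_r; lra).
repeat split; try lra; try exact Hb.
replace (stirling_remainder lnGamma k z / stirling_term k z)%C
  with (1 + stirling_remainder lnGamma (S k) z / stirling_term k z)%C.
- eapply Rle_lt_trans; [apply Cmod_triangle|]. rewrite Cmod_1. apply Rplus_lt_compat_l. exact Hb.
- destruct k as [|m]; [lia|]. rewrite stirling_remainder_S. field. easy.
Qed.
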